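(* Let $q$ be a prime power and let $n\ge 1$ and $0\le k\le n$ be integers. The number of unipotent elements of $U(n,q)$ whose fixed space has dimension $k$ is \[ \frac{|U(n,q)|}{|U(k,q)|}\cdot \frac{\big(1-\frac{1}{(-q)^k}\big)\big(1-\frac{1}{(-q)^{k+1}}\big)\cdots \big(1-\frac{1}{(-q)^{n-1}}\big)}{q^{n-k} \big(1-\frac{1}{(-q)}\big)\big(1-\frac{1}{(-q)^2}\big) \cdots \big(1-\frac{1}{(-q)^{n-k}}\big)}. \]
   Context: $U(n,q)\subset GL(n,q^2)$ is the finite unitary group, i.e. the group of invertible $n\times n$ matrices over the field $F_{q^2}$ with $q^2$ elements preserving a nondegenerate Hermitian form on $F_{q^2}^n$ (Hermitian with respect to the automorphism $a\mapsto a^q$). Its order is $|U(n,q)|=q^{\binom n2}\prod_{i=1}^n(q^i-(-1)^i)$, with $|U(0,q)|=1$. An element is unipotent if all of its eigenvalues are equal to $1$. The fixed space of $\alpha\in U(n,q)$ is $\{v\in F_{q^2}^n:\alpha v=v\}$, and its dimension is taken over $F_{q^2}$. When $k=n$ the products $(1-\frac{1}{(-q)^k})\cdots(1-\frac1{(-q)^{n-1}})$ and $(1-\frac1{(-q)})\cdots(1-\frac{1}{(-q)^{n-k}})$ are empty and equal $1$. *)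

(* Defs.v *)
From HB Require Import structures.
From mathcomp Require Export all_boot all_order all_algebra all_field.
From mathcomp Require Export sesquilinear boolp.

Set Implicit Arguments.
Unset Strict Implicit.
Unset Printing Implicit Defensive.

Import GRing.Theory.

Local Open Scope ring_scope.

(* Matrices act on column vectors, v |-> g *m v.  U(n, q) is a {set 'M[F]_n}
   rather than a subgroup of {'GL_n[F]}, because {'GL_n[F]} consists of matrices
   of size n.-1.+1, so that the case n = 0, where the group must be trivial,
   would be wrong. *)
Definition unitary_group (F : finFieldType) (theta : {rmorphism F -> F})
    (n : nat) (form : {hermitian 'cV[F]_n for false & theta}) : {set 'M[F]_n} :=
  [set g in unitmx |
     [forall u : 'cV[F]_n, forall v : 'cV[F]_n,
        form (g *m u) (g *m v) == form u v]].

(* The eigenvalues of g may lie outside F, so they are taken in arbitrary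
   extension fields of F (in particular in its algebraic closure). *)
Definition unipotent (F : fieldType) (n : nat) (g : 'M[F]_n) : Prop :=
  forall (L : fieldType) (iota : {rmorphism F -> L}) (a : L),
    eigenvalue (map_mx iota g) a -> a = 1.

Definition fixed_space (F : fieldType) (n : nat) (g : 'M[F]_n) :
    {vspace 'cV[F]_n} :=
  fixedSpace (linfun (mulmx g : 'cV[F]_n -> 'cV[F]_n)).

Definition unitary_unipotents (F : finFieldType) (theta : {rmorphism F -> F})
    (n : nat) (form : {hermitian 'cV[F]_n for false & theta}) (k : nat) :
    {set 'M[F]_n} :=
  [set g in unitary_group form | `[< unipotent g >] & \dim (fixed_space g) == k].

(* Main.v *)
(* Let N(n, k) be the number of unipotent isometries of an n-dimensional
   nondegenerate Hermitian space whose fixed space has dimension k, and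
   count the pairs (X, v) with v a nonzero vector fixed by the unipotent X.

   If v is anisotropic, X is determined by its restriction to the orthogonal
   complement of v: the pair contributes to N(n - 1, k - 1).  If v is isotropic,
   X induces a unipotent isometry Y of v^perp / <v>, of dimension m = n - 2, and
   in a basis starting with a hyperbolic pair X is given by Y, a vector w and a
   scalar t whose trace is prescribed by w.  If Y fixes a space of dimension j,
   then X fixes a space of dimension j when w is not in Im (Y - 1), and
   otherwise of dimension j + 2 for one value of t and j + 1 for the q - 1
   others.  With A and I the numbers of anisotropic and of nonzero isotropic
   vectors this gives, for k >= 1,

     (q^2k - 1) N(n, k) = A N(n - 1, k - 1)
       + I ((q^2m - q^2(m - k)) q N(m, k) + q^2(m - k + 1) (q - 1) N(m, k - 1)
            + q^2(m - k + 2) N(m, k - 2)),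

   which determines N, since N(n, 0) = 0 for n >= 1, and which the stated
   formula satisfies. *)

Require Import Defs.
From mathcomp Require Import ring zify.

Set Implicit Arguments.
Unset Strict Implicit.
Unset Printing Implicit Defensive.

Import Order.TTheory GRing.Theory Num.Theory.
Local Open Scope ring_scope.

(** * Counting by bijections and by fibres *)

Lemma card_set_bij (T1 T2 : finType) (A : {set T1}) (B : {set T2})
    (f : T1 -> T2) (g : T2 -> T1) :
  {in A, forall x, f x \in B} -> {in B, forall y, g y \in A} ->
  {in A, cancel f g} -> {in B, cancel g f} -> #|A| = #|B|.
Proof.
move=> fAB gBA fK gK; rewrite -(card_in_imset (can_in_inj fK)).
congr #|pred_of_set _|; apply/setP=> y; apply/imsetP/idP => [[x xA ->]|yB].
  exact: fAB.
by exists (g y); [exact: gBA | rewrite gK].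
Qed.

(** A single fibre with fewer than [r] elements would leave fewer than [r * s] elements in all.
    Upper bounds obtained by counting roots thus become exact fibre sizes. *)
Lemma card_fibre_eq (T1 T2 : finType) (A : {set T1}) (B : {set T2})
    (f : T1 -> T2) (r s : nat) :
  {in A, forall x, f x \in B} ->
  {in B, forall y, #|[set x in A | f x == y]| <= r}%N ->
  (#|B| <= s)%N -> #|A| = (r * s)%N ->
  {in B, forall y, #|[set x in A | f x == y]| = r}.
Proof.
move=> fAB leAr leBs cardA y yB; apply/eqP; rewrite eqn_leq leAr //= leqNgt.
apply/negP => ltr; suff: (#|A| < r * s)%N by rewrite cardA ltnn.
apply: (@leq_trans (\sum_(z in B) r)%N); last first.
  by rewrite sum_nat_const mulnC leq_mul2l leBs orbT.
have -> : #|A| = (\sum_(z in B) #|[set x in A | f x == z]|)%N.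
  rewrite -sum1_card (partition_big f (mem B)) //=.
  apply: eq_bigr => z _; rewrite -sum1_card.
  by apply: eq_bigl => x; rewrite inE.
rewrite (bigD1 y) //= [X in (_ < X)%N](bigD1 y) //= -addSn leq_add //.
by apply: leq_sum => z /andP[zB _]; exact: leAr.
Qed.

Lemma card_roots (F : finFieldType) (p : {poly F}) :
  p != 0 -> (#|[set x | root p x]| < size p)%N.
Proof.
move=> p0; rewrite cardE; apply: max_poly_roots => //; last exact: enum_uniq.
by apply/allP => x; rewrite mem_enum inE.
Qed.

(** * Norms and traces in a quadratic extension of finite fields *)

Section QuadraticExtension.

Variables (F : finFieldType) (q : nat) (theta : {rmorphism F -> F}).
Hypothesis q_gt1 : (1 < q)%N.
Hypothesis cardF : #|F| = (q ^ 2)%N.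
Hypothesis thetaE : forall a : F, theta a = a ^+ q.

Lemma theta_involutive : involutive theta.
Proof. by move=> a; rewrite !thetaE -exprM mulnn -cardF expf_card. Qed.

(** Fixed elements are roots of X^q - X. The bound is sharp by [card_theta_fixed_eq]. *)
Lemma card_theta_fixed : (#|[set c : F | theta c == c]| <= q)%N.
Proof.
have sp : size ('X^q - 'X : {poly F}) = q.+1.
  by rewrite size_polyDl size_polyXn // size_polyN size_polyX ltnS.
have p0 : ('X^q - 'X : {poly F}) != 0 by rewrite -size_poly_eq0 sp.
have := card_roots p0; rewrite sp ltnS; apply: leq_trans.
apply: subset_leq_card.
by apply/subsetP=> c; rewrite !inE thetaE rootE !hornerE subr_eq0.
Qed.

(** The fibre of c consists of roots of X^q + X - c, there are at most q values c, and q * q = |F|: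
    both bounds must be attained. *)
Lemma card_trace_fibre (b : F) : theta b = b ->
  #|[set t | t + theta t == b]| = q.
Proof.
move=> thb; have bB : b \in [set c : F | theta c == c] by rewrite inE thb.
have -> : [set t | t + theta t == b] = [set t in [set: F] | t + theta t == b].
  by apply/setP=> t; rewrite !inE.
apply: (card_fibre_eq (s := q) _ _ card_theta_fixed) bB.
- by move=> t _; rewrite inE rmorphD theta_involutive addrC.
- move=> c _; have sp : size ('X^q + ('X - c%:P) : {poly F}) = q.+1.
    by rewrite size_polyDl size_polyXn // size_XsubC ltnS.
  have p0 : ('X^q + ('X - c%:P) : {poly F}) != 0 by rewrite -size_poly_eq0 sp.
  have := card_roots p0; rewrite sp ltnS; apply: leq_trans.
  apply: subset_leq_card; apply/subsetP=> t.
  by rewrite !inE thetaE rootE !hornerE ?addrA subr_eq0 addrC.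
- by rewrite cardsT cardF mulnn.
Qed.

(** The same argument on the nonzero elements, with the roots of X^(q+1) - d, at most q - 1 nonzero
    values d, and (q + 1)(q - 1) = |F| - 1. *)
Lemma card_norm_fibre (c : F) : theta c = c -> c != 0 ->
  #|[set x | x * theta x == c]| = q.+1.
Proof.
move=> thc c0; pose B := [set d : F | theta d == d] :\ 0.
have bB : c \in B by rewrite !inE thc c0 eqxx.
have -> : [set t | t * theta t == c] = [set t in [set~ 0] | t * theta t == c].
  apply/setP=> t; rewrite !inE; case: (t =P 0) => [->|_]; rewrite ?andbT //=.
  by rewrite mul0r eq_sym (negbTE c0).
apply: (card_fibre_eq (s := q.-1) (B := B)) bB.
- move=> t; rewrite !inE => t0.
  rewrite rmorphM theta_involutive mulrC eqxx andbT.
  by rewrite mulf_neq0 // fmorph_eq0.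
- move=> d _; have sp : size ('X^(q.+1) - d%:P : {poly F}) = q.+2.
    by rewrite size_XnsubC.
  have p0 : ('X^(q.+1) - d%:P : {poly F}) != 0 by rewrite -size_poly_eq0 sp.
  have := card_roots p0; rewrite sp ltnS; apply: leq_trans.
  apply: subset_leq_card; apply/subsetP=> t.
  by rewrite !inE thetaE rootE !hornerE subr_eq0 exprS => /andP[].
- have := card_theta_fixed; rewrite (cardsD1 0) inE rmorph0 eqxx add1n /B => h.
  by rewrite -ltnS prednK ?(ltnW q_gt1) //.
- by rewrite cardsC1 cardF; nia.
Qed.

Lemma theta_trace_onto (b : F) : theta b = b -> exists t, t + theta t = b.
Proof.
move=> thb; have: (0 < #|[set t | (t + theta t == b)%R]|)%N.
  by rewrite card_trace_fibre //; exact: ltnW.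
by case/card_gt0P => t; rewrite inE => /eqP; exists t.
Qed.

Lemma theta_norm_onto (c : F) : theta c = c -> c != 0 ->
  exists x, x * theta x = c.
Proof.
move=> thc c0; have: (0 < #|[set x | (x * theta x == c)%R]|)%N.
  by rewrite card_norm_fibre.
by case/card_gt0P => t; rewrite inE => /eqP; exists t.
Qed.

End QuadraticExtension.

(** * Hermitian matrices and their splittings *)

Section HermitianMatrices.

Variables (F : fieldType) (theta : {rmorphism F -> F}).
Hypothesis thetaK : involutive theta.

Definition hadj m n (A : 'M[F]_(m, n)) : 'M[F]_(n, m) := (map_mx theta A)^T.

Local Notation "A ^!" := (hadj A) : ring_scope.

Lemma hadjK m n : cancel (@hadj m n) (@hadj n m).
Proof. by move=> A; apply/matrixP=> i j; rewrite !mxE thetaK. Qed.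

Lemma hadjM m n p (A : 'M_(m, n)) (B : 'M_(n, p)) :
  (A *m B)^! = B^! *m A^!.
Proof. by rewrite /hadj map_mxM trmx_mul. Qed.

Lemma hadjD m n (A B : 'M_(m, n)) : (A + B)^! = A^! + B^!.
Proof. by rewrite /hadj map_mxD linearD. Qed.

Lemma hadjN m n (A : 'M_(m, n)) : (- A)^! = - A^!.
Proof. by rewrite /hadj map_mxN linearN. Qed.

Lemma hadjB m n (A B : 'M_(m, n)) : (A - B)^! = A^! - B^!.
Proof. by rewrite hadjD hadjN. Qed.

Lemma hadj0 m n : (0 : 'M_(m, n))^! = 0.
Proof. by rewrite /hadj map_mx0 trmx0. Qed.

Lemma hadj_scalar n a : (a%:M : 'M_n)^! = (theta a)%:M.
Proof. by rewrite /hadj map_scalar_mx tr_scalar_mx. Qed.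

Lemma hadj1 n : (1%:M : 'M_n)^! = 1%:M.
Proof. by rewrite hadj_scalar rmorph1. Qed.

Lemma hadj_block m1 m2 n1 n2 (A : 'M_(m1, n1)) (B : 'M_(m1, n2))
    (C : 'M_(m2, n1)) (D : 'M_(m2, n2)) :
  (block_mx A B C D)^! = block_mx A^! C^! B^! D^!.
Proof. by rewrite /hadj map_block_mx tr_block_mx. Qed.

Lemma hadj_row m n1 n2 (A : 'M_(m, n1)) (B : 'M_(m, n2)) :
  (row_mx A B)^! = col_mx A^! B^!.
Proof. by rewrite /hadj map_row_mx tr_row_mx. Qed.

Lemma hadj_col m1 m2 n (A : 'M_(m1, n)) (B : 'M_(m2, n)) :
  (col_mx A B)^! = row_mx A^! B^!.
Proof. by rewrite /hadj map_col_mx tr_col_mx. Qed.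

Lemma unitmx_hadj n (A : 'M_n) : (A^! \in unitmx) = (A \in unitmx).
Proof. by rewrite unitmx_tr map_unitmx. Qed.

Definition hermitian_unit n (H : 'M[F]_n) := (H^! == H) && (H \in unitmx).

(** The Gram matrix of the rows of [P] for the form (u, v) |-> [u *m H *m v^!] on row vectors. *)
Definition congr_mx n (P H : 'M[F]_n) := P *m H *m P^!.

Lemma congr_mxM n (P Q H : 'M_n) :
  congr_mx (P *m Q) H = congr_mx P (congr_mx Q H).
Proof. by rewrite /congr_mx hadjM !mulmxA. Qed.

Lemma congr_mx1 n (H : 'M_n) : congr_mx 1%:M H = H.
Proof. by rewrite /congr_mx hadj1 mul1mx mulmx1. Qed.

Lemma congr_mxK n (P : 'M_n) : P \in unitmx ->
  cancel (congr_mx P) (congr_mx (invmx P)).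
Proof. by move=> uP H; rewrite -congr_mxM mulVmx // congr_mx1. Qed.

Lemma hadj_hermitian m n (A : 'M_(m, n)) (H : 'M_n) :
  H^! = H -> (A *m H *m A^!)^! = A *m H *m A^!.
Proof. by move=> hH; rewrite !hadjM hadjK hH mulmxA. Qed.

Lemma congr_hermitian_unit n (P H : 'M_n) :
  P \in unitmx -> hermitian_unit H -> hermitian_unit (congr_mx P H).
Proof.
move=> uP /andP[/eqP hH uH]; rewrite /hermitian_unit hadj_hermitian // eqxx.
by rewrite !unitmx_mul uP uH unitmx_hadj.
Qed.

Lemma hermitian_unit_block m n (A : 'M_m) (B : 'M_n) :
  hermitian_unit (block_mx A 0 0 B) -> hermitian_unit A && hermitian_unit B.
Proof.
rewrite /hermitian_unit hadj_block !hadj0 block_diag_mx_unit.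
by case/andP=> /eqP /eq_block_mx[-> _ _ ->] /andP[-> ->]; rewrite !eqxx.
Qed.

(** Completes [v] to a basis, the rows of [P], in which [v] comes first. *)
Lemma block_row1 n (v : 'rV[F]_(1 + n)) : v != 0 ->
  exists2 P : 'M_(1 + n), P \in unitmx & row_mx 1%:M 0 *m P = v.
Proof.
move=> v0; pose e : 'rV[F]_(1 + n) := row_mx 1%:M 0.
pose f : 'M_(1 + n) := col_mx v 0.
have ef : e *m f = v by rewrite mul_row_col mul1mx mul0mx addr0.
have [|P uP eP] := @complete_unitmx _ _ _ e f.
  by rewrite ef rank_row_mx0 mxrank1 rank_rV v0.
by exists P; rewrite // -eP.
Qed.

Lemma mx11_unit (c : 'M[F]_1) : (c \in unitmx) = (c != 0).
Proof.
rewrite unitmxE det_mx11 unitfE; congr (~~ _); apply/eqP/eqP => [c0|->].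
  by rewrite (mx11_scalar c) c0 raddf0.
by rewrite mxE.
Qed.

Lemma mul_congr_mx m n (e : 'M_(m, n)) (P H : 'M_n) :
  e *m congr_mx P H *m e^! = (e *m P) *m H *m (e *m P)^!.
Proof. by rewrite /congr_mx hadjM !mulmxA. Qed.

(** A change of basis that keeps the first block of vectors. It serves to clear off-diagonal blocks
    and to analyse matrices fixing the first basis vector. *)
Lemma congr_ublock m n (a : 'M_m) (B : 'M_(m, n)) D (L : 'M_(n, m)) M :
  congr_mx (block_mx 1%:M 0 L M) (block_mx a B B^! D) =
  block_mx a (a *m L^! + B *m M^!) (L *m a + M *m B^!)
    ((L *m a + M *m B^!) *m L^! + (L *m B + M *m D) *m M^!).
Proof.
rewrite /congr_mx hadj_block !hadj0 !hadj1 !mulmx_block.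
by rewrite !mul0mx !mulmx0 !mulmx1 !mul1mx !addr0.
Qed.

Lemma unit_lblock n (L : 'cV[F]_n) (M : 'M_n) :
  M \in unitmx -> block_mx (1%:M : 'M_1) 0 L M \in unitmx.
Proof. by rewrite !unitmxE det_lblock det1 mul1r. Qed.

Lemma row1_lblock n (L : 'cV[F]_n) (M : 'M_n) :
  row_mx 1%:M 0 *m block_mx (1%:M : 'M_1) 0 L M = row_mx 1%:M 0.
Proof. by rewrite mul_row_block !mul0mx !mul1mx !addr0. Qed.

(** One step of Gram-Schmidt: complete [v] to a basis, then project the other basis vectors onto the
    orthogonal complement of [v]. *)
Lemma anisotropic_split n (H : 'M_(1 + n)) (v : 'rV_(1 + n)) :
  hermitian_unit H -> v *m H *m v^! != 0 ->
  exists P : 'M_(1 + n), exists H' : 'M_n,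
  [/\ P \in unitmx, row_mx 1%:M 0 *m P = v,
      congr_mx P H = block_mx (v *m H *m v^!) 0 0 H' & hermitian_unit H'].
Proof.
move=> hH vHv; have v0 : v != 0.
  by apply: contraNneq vHv => ->; rewrite !mul0mx.
have [P uP eP] := block_row1 v0.
have hP := congr_hermitian_unit uP hH.
set c := v *m H *m v^!; have uc : c \in unitmx by rewrite mx11_unit.
have [B [D PH]] : exists B D, congr_mx P H = block_mx c B B^! D.
  exists (ursubmx (congr_mx P H)), (drsubmx (congr_mx P H)).
  rewrite -[LHS]submxK; congr block_mx.
    have:= mul_congr_mx (row_mx 1%:M 0) P H; rewrite eP -/c => <-.
    rewrite -{2}[congr_mx P H]submxK mul_row_block hadj_row mul_row_col.
    by rewrite hadj1 hadj0 mulmx0 addr0 mulmx1 mul1mx mul0mx addr0.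
  case/andP: hP => /eqP hP _.
  by rewrite -{1}hP -{1}[congr_mx P H]submxK hadj_block block_mxKdl.
have hc : c^! = c.
  by apply: hadj_hermitian; case/andP: hH => /eqP.
(* The multiples of [v] to add to the other basis vectors to make them orthogonal to [v]. *)
pose L := - (B^! *m invmx c).
have e1 : L *m c + B^! = 0 by rewrite mulNmx mulmxKV // addNr.
have e2 : c *m L^! + B = 0.
  by rewrite -[LHS]hadjK hadjD hadjM hadjK hc e1 hadj0.
exists (block_mx 1%:M 0 L 1%:M *m P), (L *m B + D).
have uQ : block_mx 1%:M 0 L 1%:M \in unitmx by apply/unit_lblock/unitmx1.
have E : congr_mx (block_mx 1%:M 0 L 1%:M *m P) H = block_mx c 0 0 (L *m B + D).
  by rewrite congr_mxM PH congr_ublock hadj1 !mulmx1 !mul1mx e1 e2 mul0mx add0r.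
split=> //; first by rewrite unitmx_mul uQ.
  by rewrite mulmxA row1_lblock.
have := congr_hermitian_unit uQ hP; rewrite -congr_mxM E.
by case/hermitian_unit_block/andP.
Qed.

End HermitianMatrices.

(** * Ranks of bordered matrices *)

Section Rank.
Variable F : fieldType.

Lemma rank_adds_row m n (A : 'M[F]_(m, n)) (v : 'rV_n) :
  \rank (A + v)%MS = (\rank A + ~~ (v <= A)%MS)%N.
Proof.
have [vA|vA] /= := boolP (v <= A)%MS; first by rewrite (addsmx_idPl vA) addn0.
have v0 : v != 0 by apply: contraNneq vA => ->; exact: sub0mx.
have := mxrank_sum_cap A v; rewrite rank_rV v0.
suff -> : \rank (A :&: v)%MS = 0%N by rewrite addn0.
apply/eqP; rewrite -leqn0 leqNgt; apply: contra vA => cap_gt0.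
suff vAv : (v <= A :&: v)%MS by exact: submx_trans vAv (capmxSl _ _).
by rewrite -(geq_leqif (mxrank_leqif_sup (capmxSr A v))) rank_rV v0.
Qed.

Lemma rank_row_mx m n1 n2 (A : 'M[F]_(m, n1)) (B : 'M_(m, n2)) :
  \rank (row_mx A B) = \rank (A^T + B^T)%MS.
Proof. by rewrite -mxrank_tr tr_row_mx addsmxE. Qed.

Lemma rank_row_mx_row0mx m n1 n2 n3 (A : 'M[F]_(m, n1)) (B : 'M_(m, n3)) :
  \rank (row_mx A (row_mx (0 : 'M_(m, n2)) B)) = \rank (row_mx A B).
Proof.
rewrite !rank_row_mx tr_row_mx trmx0.
have E := eqmx_trans (eqmx_sym (addsmxE (0 : 'M_(n2, m)) B^T)) (adds0mx _ B^T).
by rewrite (adds_eqmx (eqmx_refl A^T) E).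
Qed.

(** Adjoining the column [y] to [N] raises the rank by one. So does then adjoining the row, whatever
    [t], since its part [w] is already outside the row space of [N]. *)
Lemma rank_border_notin n (t : 'M_1) (w : 'rV_n) (y : 'cV_n) (N : 'M[F]_n) :
  ~~ (w <= N)%MS -> ~~ (y^T <= N^T)%MS ->
  \rank (block_mx t w y N) = (\rank N).+2.
Proof.
move=> wN yN; rewrite /block_mx -addsmxE addsmxC rank_adds_row rank_row_mx.
rewrite addsmxC rank_adds_row yN mxrank_tr.
suff -> : ~~ (row_mx t w <= row_mx y N)%MS by rewrite /= !addn1.
apply: contra wN => /submxP[z]; rewrite mul_mx_row => /eq_row_mx[_ ->].
exact: submxMl.
Qed.

(** Row and column operations clear the border and leave the Schur complement of [t]. *)
Lemma rank_border_in n (t : 'M_1) (z : 'rV_n) (x : 'cV_n) (N : 'M[F]_n) :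
  \rank (block_mx t (z *m N) (N *m x) N) = (\rank N + (t != z *m N *m x))%N.
Proof.
have E : block_mx t (z *m N) (N *m x) N =
  block_mx 1%:M z 0 1%:M *m
    (block_mx (t - z *m N *m x) 0 0 N *m block_mx 1%:M 0 x 1%:M).
  rewrite !mulmx_block !mul0mx !mulmx0 !mulmx1 !mul1mx.
  by rewrite !addr0 !add0r mulmxA subrK.
have uL : block_mx 1%:M z 0 1%:M \in unitmx.
  by rewrite unitmxE det_ublock !det1 mulr1 unitr1.
have uR : block_mx 1%:M 0 x 1%:M \in unitmx.
  by rewrite unitmxE det_lblock !det1 mulr1 unitr1.
rewrite E (eqmxMfull _ (_ : row_full _)) ?row_full_unit //.
rewrite mxrankMfree ?row_free_unit // rank_diag_block_mx addnC.
by rewrite rank_rV subr_eq0.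
Qed.

End Rank.

(** * Unipotency through the characteristic polynomial *)

Section Unipotent.
Variable F : fieldType.

(** A boolean form of [unipotent], well suited to block triangular matrices; the two agree over
    finite fields by [unipotentP]. *)
Definition unipotent_poly n (X : 'M[F]_n) :=
  char_poly X == ('X - 1%:P) ^+ n.

Lemma char_poly_lblock m n (A : 'M[F]_m) (C : 'M_(n, m)) (D : 'M_n) :
  char_poly (block_mx A 0 C D) = char_poly A * char_poly D.
Proof.
rewrite /char_poly -(det_lblock _ (- map_mx polyC C)); congr (\det _).
rewrite /char_poly_mx map_block_mx scalar_mx_block opp_block_mx add_block_mx.
by rewrite map_mx0 oppr0 addr0 add0r.
Qed.

Lemma char_poly_tr n (A : 'M[F]_n) : char_poly A^T = char_poly A.
Proof.
rewrite /char_poly -[RHS]det_tr; congr (\det _).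
by rewrite linearB /= tr_scalar_mx map_trmx.
Qed.

Lemma char_poly1 : char_poly (1%:M : 'M[F]_1) = 'X - 1%:P.
Proof. by rewrite /char_poly det_mx11 !mxE. Qed.

Lemma unipotent_poly_lblock n (y : 'cV[F]_n) (D : 'M_n) :
  unipotent_poly (block_mx (1%:M : 'M_1) 0 y D) = unipotent_poly D.
Proof.
rewrite /unipotent_poly char_poly_lblock char_poly1 exprS.
by rewrite (inj_eq (mulfI (negbT (polyXsubC_eq0 1)))).
Qed.

Lemma unipotent_poly_ublock n (y : 'rV[F]_n) (D : 'M_n) :
  unipotent_poly (block_mx (1%:M : 'M_1) y 0 D) = unipotent_poly D.
Proof.
rewrite /unipotent_poly -[in LHS]char_poly_tr tr_block_mx trmx0 tr_scalar_mx.
by rewrite [_ == _]unipotent_poly_lblock /unipotent_poly char_poly_tr.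
Qed.

Lemma char_poly_conj n (P A : 'M[F]_n) : P \in unitmx ->
  char_poly (P *m A *m invmx P) = char_poly A.
Proof.
move=> uP; rewrite /char_poly.
have -> : char_poly_mx (P *m A *m invmx P) =
   map_mx polyC P *m char_poly_mx A *m map_mx polyC (invmx P).
  rewrite /char_poly_mx mulmxBr mulmxBl !map_mxM /=; congr (_ - _).
  by rewrite scalar_mxC -mulmxA -map_mxM mulmxV // map_mx1 mulmx1.
by rewrite !det_mulmx mulrAC -det_mulmx -map_mxM mulmxV // map_mx1 det1 mul1r.
Qed.

Lemma rank_sub1_conj n (P A : 'M[F]_n) : P \in unitmx ->
  \rank (P *m A *m invmx P - 1%:M) = \rank (A - 1%:M).
Proof.
move=> uP; have -> : P *m A *m invmx P - 1%:M = P *m ((A - 1%:M) *m invmx P).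
  by rewrite mulmxBl mul1mx mulmxBr mulmxV // mulmxA.
rewrite (eqmxMfull _ (_ : row_full _)) ?row_full_unit //.
by rewrite mxrankMfree // row_free_unit unitmx_inv.
Qed.

End Unipotent.

(** * Anisotropic vectors and hyperbolic pairs *)

Section HyperbolicSplitting.

Variables (F : fieldType) (theta : {rmorphism F -> F}).
Hypothesis thetaK : involutive theta.
Hypothesis trace_onto : forall b, theta b = b -> exists t, t + theta t = b.

Local Notation "A ^!" := (hadj theta A) : ring_scope.
Local Notation congr := (congr_mx theta).

Lemma hadj_trace_onto (b : 'M_1) : b^! = b -> exists t : 'M_1, t + t^! = b.
Proof.
move=> hb; have /trace_onto[t tE] : theta (b 0 0) = b 0 0.
  by rewrite -[in RHS]hb !mxE.
exists t%:M; rewrite hadj_scalar -raddfD /= tE; exact/esym/mx11_scalar.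
Qed.

(** Were all vectors isotropic, polarization would make every product of two vectors have trace 0,
    whereas nondegeneracy gives products of trace 1. Nothing is divided by 2, so characteristic 2 is
    covered. *)
Lemma exists_anisotropic n (H : 'M_(1 + n)) : hermitian_unit theta H ->
  exists v : 'rV_(1 + n), v *m H *m v^! != 0.
Proof.
move=> /andP[/eqP hH uH]; apply: contrapT => h.
have {}h (v : 'rV_(1 + n)) : v *m H *m v^! = 0.
  by apply/eqP/negPn/negP => vHv; apply: h; exists v.
have polar (u v : 'rV_(1 + n)) : u *m H *m v^! + (u *m H *m v^!)^! = 0.
  have := h (u + v); rewrite hadjD !mulmxDl !mulmxDr !h add0r addr0 => <-.
  by rewrite !hadjM (hadjK thetaK) hH mulmxA.
have [t tE] : exists t, t + theta t = 1 by apply: trace_onto; rewrite rmorph1.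
have /row_freeP[G HG] : row_free H by rewrite row_free_unit.
pose e : 'rV[F]_(1 + n) := row_mx 1%:M 0.
(* As [G] inverts [H], these two vectors have product [t], of trace 1. *)
have := polar (t%:M *m e) (e *m (G^!)).
have -> : t%:M *m e *m H *m (e *m G^!)^! = t%:M.
  rewrite hadjM hadjK // -!mulmxA (mulmxA H) HG mul1mx.
  rewrite hadj_row mul_row_col hadj0 mulmx0 addr0 hadj1 mulmx1.
  by rewrite mulmx1.
rewrite hadj_scalar -raddfD /= tE => /matrixP/(_ 0 0)/eqP.
by rewrite !mxE oner_eq0.
Qed.

(** The Gram matrix of two isotropic vectors with product 1, followed by a basis of their orthogonal
    complement. *)
Definition hyperbolic_mx n (H : 'M[F]_n) : 'M_(1 + (1 + n)) :=
  block_mx 0 (row_mx 1%:M 0) (col_mx 1%:M 0) (block_mx 0 0 0 H).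

Lemma hyperbolic_mx_hermitian_unit n (H : 'M_n) :
  hermitian_unit theta (hyperbolic_mx H) -> hermitian_unit theta H.
Proof.
rewrite /hermitian_unit /hyperbolic_mx => /andP[/eqP hH uH].
apply/andP; split.
  move: hH; rewrite hadj_block [in LHS]hadj_block.
  by move=> /eq_block_mx[_ _ _ /eq_block_mx[_ _ _ ->]].
rewrite -row_free_unit; apply: inj_row_free => w wH.
have : row_mx (0 : 'M_1) (row_mx (0 : 'M_1) w) *m hyperbolic_mx H = 0.
  rewrite /hyperbolic_mx mul_row_block mul_row_col mul_row_block wH.
  by rewrite !mulmx0 !mul0mx !addr0 !row_mx0 addr0 row_mx0.
move: uH; rewrite -row_free_unit => /row_free_inj inj.
rewrite -(mul0mx _ (hyperbolic_mx H)) => /inj.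
by rewrite -!row_mx0 => /eq_row_mx[_ /eq_row_mx[]].
Qed.

(** Complete [v] to a basis, arrange that its products with the other vectors are 1, 0, ..., 0, then
    correct these vectors by multiples of [v]. *)
Lemma isotropic_split n (H : 'M_(1 + (1 + n))) (v : 'rV_(1 + (1 + n))) :
  hermitian_unit theta H -> v != 0 -> v *m H *m v^! = 0 ->
  exists P : 'M_(1 + (1 + n)), exists H' : 'M_n,
  [/\ P \in unitmx, row_mx 1%:M 0 *m P = v,
      congr P H = hyperbolic_mx H' & hermitian_unit theta H'].
Proof.
move=> hH v0 vHv; have [P uP eP] := block_row1 v0.
have hP := congr_hermitian_unit thetaK uP hH.
have [B [D [PH hD]]] :
    exists B D, congr P H = block_mx (0 : 'M_1) B B^! D /\ D^! = D.
  exists (ursubmx (congr P H)), (drsubmx (congr P H)).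
  case/andP: hP => /eqP hP _; move: (hP).
  rewrite -{1 2}[congr P H]submxK hadj_block => /eq_block_mx[_ _ h2 h3].
  split => //; rewrite -[LHS]submxK h2; congr block_mx.
  have:= mul_congr_mx theta (row_mx 1%:M 0) P H; rewrite eP vHv => <-.
  rewrite -{2}[congr P H]submxK mul_row_block hadj_row mul_row_col.
  by rewrite hadj1 hadj0 mulmx0 addr0 mulmx1 mul1mx mul0mx addr0.
(* Otherwise [v] would lie in the radical of the form. *)
have B0 : B != 0.
  apply/eqP => B0; case/andP: hP => _; rewrite -row_free_unit PH B0 hadj0.
  move/row_free_inj => inj.
  have e0 : row_mx (1%:M : 'M_1) (0 : 'rV_(1 + n)) *m
      block_mx (0 : 'M_1) 0 0 D = 0 *m block_mx (0 : 'M_1) 0 0 D.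
    by rewrite mul_row_block !mulmx0 !mul0mx !addr0 row_mx0.
  have := inj _ _ _ e0; rewrite -[RHS]row_mx0.
  case/eq_row_mx=> /matrixP/(_ 0 0)/eqP.
  by rewrite !mxE oner_eq0.
have [M uM eM] := block_row1 B0.
(* Chosen so that the products of [v] with the new vectors form the row [B *m Q^!] = (1, 0). *)
pose Q := (invmx M)^!.
have uQ : Q \in unitmx by rewrite unitmx_hadj unitmx_inv.
have BQ : B *m Q^! = row_mx 1%:M 0 by rewrite -eM hadjK // mulmxK.
have [d [b [D2 [D1E hd]]]] : exists d b D2,
    Q *m D *m Q^! = block_mx (d : 'M_1) b b^! D2 /\ d^! = d.
  exists (ulsubmx (congr Q D)), (ursubmx (congr Q D)), (drsubmx (congr Q D)).
  have : (congr Q D)^! = congr Q D by exact: hadj_hermitian.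
  rewrite -{1 2}[congr Q D]submxK hadj_block => /eq_block_mx[h1 _ h2 _].
  by split=> //; rewrite h2 submxK.
(* Adding [s] times [v] to the second vector changes its norm from [d] to [d + s + s^!] = 0;
   subtracting multiples [b^!] of [v] from the later vectors makes them orthogonal to it. *)
have [s sE] := hadj_trace_onto (b := - d) (etrans (hadjN _ _) (congr1 -%R hd)).
pose L : 'cV_(1 + n) := col_mx s (- b^!).
pose R := block_mx (1%:M : 'M_1) 0 L 1%:M *m block_mx (1%:M : 'M_1) 0 0 Q.
have uR : R \in unitmx.
  by rewrite unitmx_mul !unit_lblock // unitmx1.
have E : congr (R *m P) H = hyperbolic_mx D2.
  rewrite congr_mxM PH congr_mxM congr_ublock // BQ.
  rewrite hadj0 !mulmx0 !mul0mx !add0r.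
  rewrite (_ : Q *m B^! = (row_mx 1%:M 0)^!); last first.
    by rewrite -BQ hadjM hadjK.
  rewrite D1E congr_ublock !mul0mx mulmx0 add0r.
  rewrite hadj1 !mulmx1 !mul1mx add0r /hyperbolic_mx.
  rewrite hadj_row hadj1 hadj0 /L hadj_col hadjN hadjK //.
  rewrite !mul_col_row !mulmx1 !mul1mx !mulmx0 !mul0mx !add_block_mx.
  rewrite !add0r !addNr !addrA (addrC s^!) sE addNr.
  by [].
exists (R *m P), D2; split=> //; first by rewrite unitmx_mul uR.
  by rewrite /R !mulmxA !row1_lblock.
apply: hyperbolic_mx_hermitian_unit; rewrite -E.
by apply: congr_hermitian_unit => //; rewrite unitmx_mul uR.
Qed.

End HyperbolicSplitting.

Lemma card_rowspace (F : finFieldType) m n (A : 'M[F]_(m, n)) :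
  #|[set w : 'rV_n | (w <= A)%MS]| = (#|F| ^ \rank A)%N.
Proof.
have inj := row_free_inj (row_base_free A).
rewrite -[X in (_ ^ X)%N]mul1n -card_mx -(card_imset _ (@inj 1%N)).
apply: eq_card => w; rewrite inE -(eq_row_base A).
by apply/submxP/imsetP => -[z]; [move=> -> | move=> _ ->]; exists z.
Qed.

(** * Counting vectors of given norm *)

Section Counting.

Variables (F : finFieldType) (q : nat) (theta : {rmorphism F -> F}).
Hypothesis q_gt1 : (1 < q)%N.
Hypothesis cardF : #|F| = (q ^ 2)%N.
Hypothesis thetaE : forall a : F, theta a = a ^+ q.

Let thetaK := theta_involutive cardF thetaE.
Let trace_onto := theta_trace_onto q_gt1 cardF thetaE.
Let norm_onto := theta_norm_onto q_gt1 cardF thetaE.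

Local Notation "A ^!" := (hadj theta A) : ring_scope.
Local Notation congr := (congr_mx theta).

(** The trace divides the q^2 elements of [F] into fibres of size q, one over each fixed element. *)
Lemma card_theta_fixed_eq : #|[set c : F | theta c == c]| = q.
Proof.
have : (#|F| = \sum_(c in [set c : F | theta c == c]) q)%N.
  rewrite -sum1_card (partition_big (fun t => t + theta t)
    (mem [set c : F | theta c == c])) /=.
    apply: eq_bigr => c; rewrite inE => /eqP thc.
    rewrite -(card_trace_fibre q_gt1 cardF thetaE thc) -sum1_card.
    by apply: eq_bigl => t; rewrite !inE.
  by move=> t _; rewrite inE rmorphD thetaK addrC.
rewrite cardF sum_nat_const -mulnn => /eqP; rewrite eqn_pmul2r ?(ltnW q_gt1) //.
by move=> /eqP.
Qed.

Definition hnorm n (H : 'M[F]_n) (v : 'rV_n) : F := (v *m H *m v^!) 0 0.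

(** For [c] = 0 the zero vector is included. *)
Definition nvec n (H : 'M[F]_n) (c : F) := #|[set v | hnorm H v == c]|.

Arguments nvec {n} H%_R c%_R.

Lemma hnorm_fixed n (H : 'M_n) v : H^! = H -> theta (hnorm H v) = hnorm H v.
Proof.
move=> hH; have /matrixP/(_ 0 0) E := hadj_hermitian thetaK v hH.
by rewrite /hnorm -[RHS]E [RHS]mxE [RHS]mxE.
Qed.

Lemma hnorm_mx n (H : 'M_n) v : v *m H *m v^! = (hnorm H v)%:M.
Proof. exact: mx11_scalar. Qed.

Lemma nvec_congr n (P H : 'M_n) c : P \in unitmx ->
  nvec (congr P H) c = nvec H c.
Proof.
move=> uP; have E v : hnorm (congr P H) v = hnorm H (v *m P).
  by rewrite /hnorm mul_congr_mx.
rewrite /nvec.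
apply: (card_set_bij (f := mulmx^~ P) (g := mulmx^~ (invmx P))) => v.
- by rewrite !inE E.
- by rewrite !inE E mulmxKV.
- by rewrite mulmxK.
- by rewrite mulmxKV.
Qed.

Lemma nvec_scale n (H : 'M_n) c x : x != 0 ->
  nvec H (x * theta x * c) = nvec H c.
Proof.
move=> x0; have E y v : hnorm H (y *: v) = y * theta y * hnorm H v.
  rewrite /hnorm -scalemxAl -scalemxAl /hadj map_mxZ linearZ -scalemxAr.
  by rewrite scalerA mxE.
symmetry; rewrite /nvec.
apply: (card_set_bij (f := *:%R x) (g := *:%R x^-1)) => v.
- by rewrite !inE E => /eqP->.
- rewrite !inE E => /eqP->; rewrite fmorphV.
  have tx0 : theta x != 0 by rewrite fmorph_eq0.
  by apply/eqP; field; rewrite x0 tx0.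
- by rewrite scalerA mulVf // scale1r.
- by rewrite scalerA mulfV // scale1r.
Qed.

(** Such a [c] is the norm of a scalar, and scaling vectors by that scalar is a bijection. *)
Lemma nvec_nonzero n (H : 'M_n) c :
  theta c = c -> c != 0 -> nvec H c = nvec H 1.
Proof.
move=> thc c0; have [x xE] := norm_onto thc c0.
rewrite -[c]mulr1 -xE nvec_scale //.
by apply: contraNneq c0 => x0; rewrite -xE x0 mul0r.
Qed.

Lemma nvec_total n (H : 'M_n) : H^! = H ->
  (q ^ (2 * n) = nvec H 0 + q.-1 * nvec H 1)%N.
Proof.
move=> hH; rewrite expnM -cardF -[n in LHS]mul1n -card_mx -cardsT -sum1_card.
rewrite (partition_big (hnorm H) (mem [set c : F | theta c == c])); last first.
  by move=> v _; rewrite /= inE; apply/eqP/hnorm_fixed.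
have E (c : F) : (\sum_(v in [set: 'rV[F]_n] | hnorm H v == c) 1 = nvec H c)%N.
  by rewrite /nvec -sum1_card; apply: eq_bigl => t; rewrite !inE.
rewrite (bigD1 0) /= ?inE ?rmorph0 // E; congr (_ + _)%N.
have -> : q.-1 = #|[set c : F | theta c == c] :\ 0|.
  have := card_theta_fixed_eq.
  by rewrite (cardsD1 0) inE rmorph0 eqxx add1n => <-.
rewrite -sum_nat_const; apply: eq_big => [c|c /andP[]].
  by rewrite !inE andbC.
by rewrite inE => /eqP thc c0; rewrite E nvec_nonzero.
Qed.

Lemma nvec_block n (a : 'M_1) (H : 'M_n) c :
  nvec (block_mx a 0 0 H) c =
    (\sum_(x : F) nvec H (c - x * theta x * a ord0 ord0))%N.
Proof.
rewrite /nvec -sum1_card (partition_big (fun v => lsubmx v 0 0) predT) //=.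
apply: eq_bigr => x _; rewrite sum1dep_card.
have E (v : 'rV_n) : hnorm (block_mx a 0 0 H) (row_mx (x%:M) v) =
   x * theta x * a 0 0 + hnorm H v.
  rewrite /hnorm mul_row_block hadj_row mul_row_col !mulmx0 addr0 add0r mxE.
  congr (_ + _); rewrite (mx11_scalar a) hadj_scalar -!scalar_mxM !mxE /=.
  by rewrite mulr1n mulrAC.
apply: (card_set_bij (f := fun v => rsubmx v) (g := row_mx x%:M)) => v.
- rewrite !inE => /andP[/eqP <- /eqP xE].
  have := E (rsubmx v); rewrite -{1}xE -mx11_scalar hsubmxK => ->.
  by rewrite addrAC subrr add0r.
- rewrite !inE E => /eqP ->; rewrite addrC subrK eqxx /=.
  by rewrite row_mxKl !mxE eqxx.
- rewrite !inE => /andP[_ /eqP <-].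
  by rewrite -[in RHS](hsubmxK v) -mx11_scalar.
- by rewrite row_mxKr.
Qed.

(** For each of the q^2 - 1 nonzero first coordinates, the other coordinates must have a prescribed
    nonzero fixed norm, and all such norms are equally frequent. *)
Lemma nvec0_rec n (a : 'M_1) (H : 'M_n) : a^! = a -> a != 0 ->
  nvec (block_mx a 0 0 H) 0 = (nvec H 0 + (q ^ 2).-1 * nvec H 1)%N.
Proof.
move=> ha a0; have tha : theta (a 0 0) = a 0 0.
  by rewrite -[in RHS]ha !mxE.
have {}a0 : a 0 0 != 0.
  apply: contraNneq a0 => a00; rewrite (mx11_scalar a) a00; exact/eqP/raddf0.
rewrite nvec_block (bigD1 0) //= !mul0r subr0; congr (_ + _)%N.
rewrite -cardF -(cardsC1 (0 : F)) -sum_nat_const.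
apply: eq_big => [x|x x0]; first by rewrite !inE.
rewrite sub0r nvec_nonzero //.
  by rewrite rmorphN !rmorphM thetaK tha (mulrC (theta x)).
by rewrite oppr_eq0 !mulf_neq0 // fmorph_eq0.
Qed.

Lemma nvec0_dim0 (H : 'M_0) : nvec H 0 = 1%N.
Proof.
rewrite -(cards1 (0 : 'rV[F]_0)); apply: eq_card => v.
by rewrite !inE [v]thinmx0 eqxx /hnorm !mul0mx mxE eqxx.
Qed.

(** Induction by splitting off an anisotropic vector yields the isotropic count, and [nvec_total]
    then the count for norm 1. The factor q on the left avoids the exponents 2n - 1 and n - 1,
    negative for n = 0. *)
Lemma nvecE n (H : 'M_n) : hermitian_unit theta H ->
  (nvec H 0)%:R * q%:R = q%:R ^+ (2 * n) + (- q%:R) ^+ n * (q%:R - 1) :> rat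
  /\ (nvec H 1)%:R * q%:R = q%:R ^+ n * (q%:R ^+ n - (-1) ^+ n) :> rat.
Proof.
have q0 : q%:R != 0 :> rat by rewrite pnatr_eq0 -lt0n ltnW.
have q1 : q%:R - 1 != 0 :> rat by rewrite subr_eq0 pnatr_eq1 gtn_eqF.
have step m (G : 'M_m) : G^! = G ->
   (nvec G 0)%:R * q%:R = q%:R ^+ (2 * m) + (- q%:R) ^+ m * (q%:R - 1) :> rat ->
   (nvec G 1)%:R * q%:R = q%:R ^+ m * (q%:R ^+ m - (-1) ^+ m) :> rat.
  move=> hG E; have := congr1 (fun x => x%:R : rat) (nvec_total hG).
  rewrite natrD natrM -subn1 natrB ?(ltnW q_gt1) // natrX => T.
  apply: (mulfI q1); rewrite mulrA -[(q%:R - 1) * _](addKr (nvec G 0)%:R) -T.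
  rewrite mulrDl mulNr E exprNn mul2n -addnn exprD; ring.
elim: n H => [|n IHn] H hH.
  have h0 : (nvec H 0)%:R * q%:R =
      q%:R ^+ (2 * 0) + (- q%:R) ^+ 0 * (q%:R - 1) :> rat.
    by rewrite nvec0_dim0 mul1r muln0 !expr0; ring.
  by split=> //; apply: step => //; case/andP: hH => /eqP.
suff h0 : (nvec H 0)%:R * q%:R =
    q%:R ^+ (2 * n.+1) + (- q%:R) ^+ n.+1 * (q%:R - 1) :> rat.
  by split=> //; apply: step => //; case/andP: hH => /eqP.
have [v vHv] := exists_anisotropic thetaK trace_onto (n := n) hH.
have [P [H' [uP _ E hH']]] := anisotropic_split thetaK (n := n) hH vHv.
have [E0 E1] := IHn _ hH'.
rewrite -(nvec_congr _ _ uP) E nvec0_rec //; last first.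
  by apply: (hadj_hermitian thetaK); case/andP: hH => /eqP.
rewrite natrD natrM mulrDl E0 -mulrA E1 -subn1 natrB ?expn_gt0 ?(ltnW q_gt1) //.
rewrite natrX mulnS exprD -(mulnC n) !exprM !(exprSr (- q%:R)) !(exprNn q%:R n).
move: (q%:R ^+ n) ((-1) ^+ n) => Y e; ring.
Qed.

End Counting.

(** * Isometries fixing the first basis vector *)

Section Blocks.

Variables (F : fieldType) (theta : {rmorphism F -> F}).
Hypothesis thetaK : involutive theta.

Local Notation "A ^!" := (hadj theta A) : ring_scope.
Local Notation congr := (congr_mx theta).

Lemma row1_fixed n (Y : 'M[F]_(1 + n)) :
  (row_mx 1%:M 0 *m Y == row_mx 1%:M 0) =
  (Y == block_mx 1%:M 0 (dlsubmx Y) (drsubmx Y)).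
Proof.
rewrite -{1}[Y]submxK mul_row_block !mul1mx !mul0mx !addr0.
apply/eqP/eqP => [/eq_row_mx[ul ur]|YE].
  by rewrite -[LHS]submxK ul ur.
by rewrite YE block_mxKul block_mxKur.
Qed.

Lemma congr_diag n (c : 'M_1) (H : 'M[F]_n) (y : 'cV_n) (Y : 'M_n) :
  congr (block_mx 1%:M 0 y Y) (block_mx c 0 0 H) =
  block_mx c (c *m y^!) (y *m c) (y *m c *m y^! + congr Y H).
Proof.
have := congr_ublock theta c 0 H y Y.
by rewrite hadj0 !mul0mx !mulmx0 !addr0 !add0r.
Qed.

(** Keeping the products with a fixed anisotropic vector forces the orthogonal complement to be
    preserved. *)
Lemma congr_diag_fixed n (c : 'M_1) (H H2 : 'M[F]_n) (Y : 'M_(1 + n)) :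
  c != 0 ->
  (row_mx 1%:M 0 *m Y == row_mx 1%:M 0)
    && (congr Y (block_mx c 0 0 H) == block_mx c 0 0 H2) =
  (Y == block_mx 1%:M 0 0 (drsubmx Y)) && (congr (drsubmx Y) H == H2).
Proof.
rewrite -mx11_unit => uc; rewrite row1_fixed.
apply/andP/andP => -[/eqP YE /eqP HE].
  move: HE; rewrite YE congr_diag => /eq_block_mx[_ _ ylc].
  have -> : dlsubmx Y = 0 by rewrite -[LHS](mulmxK uc) ylc mul0mx.
  by rewrite !mul0mx add0r block_mxKdr => ->; rewrite !eqxx.
by rewrite YE block_mxKdl block_mxKdr congr_diag hadj0 !mul0mx mulmx0 add0r HE.
Qed.

(* With Y an isometry of H and t + t^! = - w H w^!, these are the isometries of
   [hyperbolic_mx H] fixing its first basis vector. *)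
Definition hyperbolic_isometry n (H Y : 'M[F]_n) (w : 'rV_n) (t : 'M_1) :
    'M_(1 + (1 + n)) :=
  block_mx 1%:M 0 (col_mx t (- (Y *m H *m w^!))) (block_mx 1%:M w 0 Y).

(** Products with the fixed vector make the lower right block of [Z] block triangular; the other
    products determine the remaining column, make [Y] an isometry and prescribe the trace of [t]. *)
Lemma congr_hyperbolic_fixed n (H : 'M[F]_n) (Z : 'M_(1 + (1 + n))) :
  H^! = H ->
  let Y := drsubmx (drsubmx Z) in
  let w := ursubmx (drsubmx Z) in
  let t := usubmx (dlsubmx Z) in
  (row_mx 1%:M 0 *m Z == row_mx 1%:M 0)
    && (congr Z (hyperbolic_mx H) == hyperbolic_mx H) =
  [&& Z == hyperbolic_isometry H Y w t, congr Y H == H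
    & t + t^! + w *m H *m w^! == 0].
Proof.
move=> hH Y w t; rewrite row1_fixed.
have E y Z2 : congr (block_mx 1%:M 0 y Z2) (hyperbolic_mx H) =
   block_mx 0 (row_mx 1%:M 0 *m Z2^!) (Z2 *m (row_mx 1%:M 0)^!)
    (Z2 *m (row_mx 1%:M 0)^! *m y^!
     + (y *m row_mx 1%:M 0 + Z2 *m block_mx 0 0 0 H) *m Z2^!).
  rewrite /hyperbolic_mx -[col_mx 1%:M 0](_ : (row_mx 1%:M 0)^! = _).
    by rewrite congr_ublock !mul0mx mulmx0 !add0r.
  by rewrite hadj_row hadj1 hadj0.
have E2 y w' Y' : congr (block_mx 1%:M 0 (col_mx t y) (block_mx 1%:M w' 0 Y'))
     (hyperbolic_mx H) =
   block_mx 0 (row_mx 1%:M 0) (col_mx 1%:M 0)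
     (block_mx (t^! + (t + w' *m H *m w'^!)) (y^! + w' *m H *m Y'^!)
        (y + Y' *m H *m w'^!) (congr Y' H)).
  rewrite E hadj_row !hadj0 !hadj1 hadj_block hadj_col hadj0 hadj1.
  pose simp := (mulmx1, mul1mx, mulmx0, mul0mx, addr0, add0r).
  rewrite mul_row_block mul_block_col !simp !mul_col_row mulmx_block !simp.
  by rewrite add_block_mx !simp mulmx_block !simp add_block_mx !simp.
apply/andP/and3P => [[/eqP ZE]|[/eqP ZE /eqP YE /eqP tE]].
  rewrite ZE => /eqP hZ.
  (* Compares the products with the fixed isotropic vector. *)
  have : drsubmx Z *m (row_mx 1%:M 0)^! = (row_mx 1%:M 0)^!.
    move: hZ; rewrite E => /eq_block_mx[_ _ -> _].
    by rewrite hadj_row hadj1 hadj0.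
  rewrite -{1}[drsubmx Z]submxK hadj_row hadj1 hadj0 mul_block_col.
  rewrite !mulmx1 !mulmx0 !addr0 => /eq_col_mx[ul dl].
  have Z2E : drsubmx Z = block_mx 1%:M w 0 Y by rewrite -[LHS]submxK ul dl.
  have Z1E : dlsubmx Z = col_mx t (dsubmx (dlsubmx Z)) by rewrite vsubmxK.
  move: hZ; rewrite Z2E Z1E E2.
  case/eq_block_mx=> _ _ _ /eq_block_mx[h1 _ h3 h4].
  have yE : dsubmx (dlsubmx Z) = - (Y *m H *m w^!).
    by apply/eqP; rewrite -addr_eq0 h3.
  split; last by rewrite -h1 addrA (addrC t).
    by rewrite /hyperbolic_isometry -yE -Z1E -Z2E.
  exact/eqP.
split.
  have -> : drsubmx Z = block_mx 1%:M w 0 Y by rewrite ZE block_mxKdr.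
  have -> : dlsubmx Z = col_mx t (- (Y *m H *m w^!)) by rewrite ZE block_mxKdl.
  exact/eqP.
rewrite {1}ZE /hyperbolic_isometry E2 YE /hyperbolic_mx.
rewrite addrA (addrC t^!) tE addNr hadjN !hadjM hadjK // hH !mulmxA addNr.
by [].
Qed.

(** Deletes the first row and the second column, both zero in the difference. *)
Lemma rank_hyperbolic_isometry n (H Y : 'M_n) w t :
  \rank (hyperbolic_isometry H Y w t - 1%:M) =
  \rank (block_mx t w (- (Y *m H *m w^!)) (Y - 1%:M)).
Proof.
rewrite /hyperbolic_isometry [X in _ - X]scalar_mx_block.
rewrite opp_block_mx add_block_mx subrr subr0 oppr0 addr0.
rewrite [X in _ - X]scalar_mx_block opp_block_mx add_block_mx subrr subr0.
rewrite !oppr0 !addr0 /block_mx row_mx0 rank_col_0mx -/(block_mx _ _ _ _).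
by rewrite block_mxEh col_mx0 rank_row_mx_row0mx -block_mxEh.
Qed.

(** As [Y] is an isometry, the border column lies in the column space of [Y - 1%:M] only if [w] lies
    in its row space, so [rank_border_notin] applies. *)
Lemma rank_hyperbolic_isometry_notin n (H Y : 'M_n) w t :
  H \in unitmx -> congr Y H = H -> ~~ (w <= Y - 1%:M)%MS ->
  \rank (hyperbolic_isometry H Y w t - 1%:M) = (\rank (Y - 1%:M)).+2.
Proof.
move=> uH YH wY; rewrite rank_hyperbolic_isometry rank_border_notin //.
apply: contra wY => /submxP[z] /(congr1 trmx); rewrite trmx_mul !trmxK => yE.
have uYH : Y *m H \in unitmx.
  by move: (uH); rewrite -{1}YH unitmx_mul => /andP[].
(* Solves for [w] by means of Y H (Y^! - 1) = - (Y - 1) H, which is the isometry condition. *)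
have -> : w = (invmx H *m z^T)^! *m (Y - 1%:M).
  apply: (can_inj (@hadjK _ _ thetaK 1 n)).
  rewrite hadjM (hadjK thetaK) hadjB hadj1.
  apply: (can_inj (mulKmx uYH)).
  rewrite -[LHS]opprK yE mulmxA mulmxBr -/(congr Y H) YH mulmx1 mulmxA.
  by rewrite [(H - _) *m _]mulmxBl mulmxV // mulmxK // -mulNmx opprB.
exact: submxMl.
Qed.

(** The border column is here [Y - 1%:M] applied to [H *m z^!], so [rank_border_in] singles out one
    value of [t]. *)
Lemma rank_hyperbolic_isometry_in n (H Y : 'M_n) z t :
  congr Y H = H ->
  \rank (hyperbolic_isometry H Y (z *m (Y - 1%:M)) t - 1%:M) =
  (\rank (Y - 1%:M)%R + (t != z *m (Y - 1%:M) *m (H *m z^!))%R)%N.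
Proof.
move=> YH; rewrite rank_hyperbolic_isometry -rank_border_in.
congr (\rank (block_mx _ _ _ _)).
have -> : Y *m H *m (z *m (Y - 1%:M))^! = (H - Y *m H) *m z^!.
  by rewrite hadjM hadjB hadj1 mulmxA mulmxBr -/(congr Y H) YH mulmx1.
by rewrite -mulNmx opprB mulmxA (mulmxBl Y) mul1mx.
Qed.

End Blocks.

(** * The order of the unitary group *)

Section UnitaryCounting.

Variables (F : finFieldType) (q : nat) (theta : {rmorphism F -> F}).
Hypothesis q_gt1 : (1 < q)%N.
Hypothesis cardF : #|F| = (q ^ 2)%N.
Hypothesis thetaE : forall a : F, theta a = a ^+ q.

Let thetaK := theta_involutive cardF thetaE.
Let trace_onto := theta_trace_onto q_gt1 cardF thetaE.

Local Notation "A ^!" := (hadj theta A) : ring_scope.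
Local Notation congr := (congr_mx theta).

(** Two matrices are allowed because, in the induction on the dimension, the complements of two
    vectors of equal norm come with unrelated Gram matrices. *)
Definition isometries n (H K : 'M[F]_n) : {set 'M[F]_n} :=
  [set X | congr X H == K].

Lemma card_isometries_congr n (P H K : 'M_n) : P \in unitmx ->
  #|isometries H (congr P K)| = #|isometries H K|.
Proof.
move=> uP; apply: (card_set_bij (f := mulmx (invmx P)) (g := mulmx P)) => X.
- by rewrite !inE congr_mxM => /eqP->; rewrite congr_mxK.
- by rewrite !inE congr_mxM => /eqP->.
- by rewrite mulKVmx.
- by rewrite mulKmx.
Qed.

Lemma card_isometries_fibre m n (e : 'M_(m, n)) (P H K : 'M_n) : P \in unitmx ->
  #|[set X in isometries H K | e *m X == e *m P]| =
  #|[set Y in isometries (congr P H) K | e *m Y == e]|.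
Proof.
move=> uP.
apply: (card_set_bij (f := mulmx^~ (invmx P)) (g := mulmx^~ P)) => X.
- rewrite !inE congr_mxM congr_mxK // => /andP[-> /eqP eX].
  by rewrite mulmxA eX mulmxK ?eqxx.
- by rewrite !inE congr_mxM => /andP[-> /eqP eX]; rewrite mulmxA eX eqxx.
- by rewrite mulmxKV.
- by rewrite mulmxK.
Qed.

Lemma card_isometries_diag n (c : 'M_1) (H K : 'M_n) : c != 0 ->
  #|[set Y in isometries (block_mx c 0 0 H) (block_mx c 0 0 K)
       | row_mx 1%:M 0 *m Y == row_mx 1%:M 0]| = #|isometries H K|.
Proof.
move=> c0.
apply: (card_set_bij (f := drsubmx) (g := block_mx (1%:M : 'M_1) 0 0)) => Y.
- by rewrite !inE andbC congr_diag_fixed // => /andP[].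
- by rewrite !inE andbC congr_diag_fixed // block_mxKdr eqxx.
- rewrite !inE andbC congr_diag_fixed // => /andP[/eqP -> _].
  by rewrite block_mxKdr.
- by rewrite block_mxKdr.
Qed.

(** Factor [i] is the number of vectors of norm 1 in dimension i + 1. The powers of q multiply to
    q^(n(n-1)/2). *)
Definition unitary_order n : rat :=
  \prod_(i < n) (q%:R ^+ i * (q%:R ^+ i.+1 - (-1) ^+ i.+1)).

Lemma card_isometries n (H K : 'M_n) :
  hermitian_unit theta H -> hermitian_unit theta K ->
  #|isometries H K|%:R = unitary_order n.
Proof.
elim: n H K => [|n IHn] H K hH hK.
  rewrite /unitary_order big_ord0 (_ : #|_| = 1%N) //.
  rewrite -(cards1 (0 : 'M[F]_0)); apply: eq_card => X.
  by rewrite !inE [X]flatmx0 [K]flatmx0 eqxx; apply/eqP; exact: flatmx0.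
have [u uKu] := exists_anisotropic thetaK trace_onto (n := n) hK.
have [R [K' [uR _ RK hK']]] := anisotropic_split thetaK (n := n) hK uKu.
rewrite -(card_isometries_congr _ _ uR) RK.
have hc := hadj_hermitian thetaK u (eqP (andP hK).1).
set c := u *m K *m u^! in uKu RK hc *.
pose e : 'rV[F]_(1 + n) := row_mx 1%:M 0.
have -> : #|isometries H (block_mx c 0 0 K')| =
  (\sum_(v : 'rV_(1 + n) | hnorm theta H v == c ord0 ord0)
     #|[set X in isometries H (block_mx c 0 0 K') | (e *m X == v)%R]|)%N.
  rewrite -sum1_card (partition_big (fun X : 'M_(1 + n) => e *m X)
    (fun v => hnorm theta H v == c ord0 ord0)) /=.
    apply: eq_bigr => v _; rewrite -sum1_card.
    by apply: eq_bigl => X; rewrite !inE.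
  move=> X; rewrite inE => /eqP XE.
  have := mul_congr_mx theta e X H.
  rewrite XE mul_row_block hadj_row mul_row_col.
  by rewrite hadj0 hadj1 !mulmx0 mul1mx !addr0 mulmx1 /hnorm => ->.
(* Once [v] is moved to the first basis vector, its fibre consists of the isometries between two
   complements. *)
rewrite natr_sum (eq_bigr (fun=> unitary_order n)) => [|v /eqP vc]; last first.
  have vHv : v *m H *m v^! = c by rewrite hnorm_mx vc -mx11_scalar.
  have [|P [H' [uP vP PH hH']]] := anisotropic_split thetaK (v := v) hH.
    by rewrite vHv.
  rewrite -vP card_isometries_fibre // PH vHv card_isometries_diag //.
  exact: IHn.
rewrite sumr_const -[_ *+ _]mulr_natl.
have -> : #|(fun v : 'rV_(1 + n) => hnorm theta H v == c ord0 ord0)| =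
    nvec theta H 1.
  rewrite -(nvec_nonzero q_gt1 cardF thetaE H (c := c ord0 ord0)).
  - by rewrite /nvec cardsE; apply: eq_card.
  - by rewrite -[in RHS]hc !mxE.
  - apply: contraNneq uKu => c0; rewrite (mx11_scalar c) c0; exact/eqP/raddf0.
rewrite /unitary_order big_ord_recr /= [RHS]mulrC; congr (_ * _).
have [_ E] := nvecE q_gt1 cardF thetaE hH.
have q0 : q%:R != 0 :> rat by rewrite pnatr_eq0 -lt0n ltnW.
apply: (mulIf q0); rewrite E !exprS.
by move: (q%:R ^+ n) ((-1) ^+ n) => Y s; ring.
Qed.

End UnitaryCounting.

(** * Counting unipotent isometries *)

Section UnipotentCounting.

Variables (F : finFieldType) (q : nat) (theta : {rmorphism F -> F}).
Hypothesis q_gt1 : (1 < q)%N.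
Hypothesis cardF : #|F| = (q ^ 2)%N.
Hypothesis thetaE : forall a : F, theta a = a ^+ q.

Let thetaK := theta_involutive cardF thetaE.

Local Notation "A ^!" := (hadj theta A) : ring_scope.
Local Notation congr := (congr_mx theta).

Definition unipotent_isometries n (H : 'M[F]_n) : {set 'M[F]_n} :=
  [set X in isometries theta H H | unipotent_poly X].

(** By rank-nullity, the row vectors fixed by [X] form a space of dimension [k]. *)
Definition unipotents n (H : 'M[F]_n) (k : nat) : {set 'M[F]_n} :=
  [set X in unipotent_isometries H | (\rank (X - 1%:M)%R + k == n)%N].

Lemma unipotents_gt n (H : 'M_n) k : (n < k)%N -> #|unipotents H k| = 0%N.
Proof.
move=> ltnk; apply: eq_card0 => X; rewrite !inE; apply/negbTE.
by rewrite negb_and neq_ltn (leq_trans ltnk (leq_addl _ _)) !orbT.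
Qed.

(** In positive dimension 1 is a root of the characteristic polynomial, hence an eigenvalue. *)
Lemma unipotents_0 n (H : 'M_n.+1) : #|unipotents H 0| = 0%N.
Proof.
apply: eq_card0 => X; rewrite !inE -andbA.
apply/negbTE/negP => /and3P[_ /eqP uX].
have : eigenvalue X 1.
  by rewrite eigenvalue_root_char uX rootE !hornerE subrr expr0n.
by rewrite /eigenvalue kermx_eq0 /row_free addn0 => /negbTE->.
Qed.

(** Conjugation by [P] takes the place of the translation in [card_isometries_fibre], since it
    preserves unipotency and the rank of [X - 1%:M]. *)
Lemma card_unipotents_fibre m n (e : 'M_(m, n)) (P H : 'M_n) k :
  P \in unitmx ->
  #|[set X in unipotents H k | e *m P *m X == e *m P]| =
  #|[set Y in unipotents (congr P H) k | e *m Y == e]|.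
Proof.
move=> uP; have uV : invmx P \in unitmx by rewrite unitmx_inv.
have conjE X : (P *m X *m invmx P \in unipotents (congr P H) k) =
    (X \in unipotents H k).
  rewrite !inE /unipotent_poly char_poly_conj // rank_sub1_conj //.
  congr (_ && _ && _); rewrite -!congr_mxM mulmxKV // congr_mxM.
  by rewrite (can_eq (congr_mxK theta uP)).
apply: (card_set_bij (f := fun X => P *m X *m invmx P)
          (g := fun Y => invmx P *m Y *m P)) => X.
- case/setIdP=> XU /eqP eX; apply/setIdP; rewrite conjE; split=> //.
  by rewrite !mulmxA eX mulmxK.
- case/setIdP=> XU /eqP eX; apply/setIdP; rewrite -conjE !mulmxA mulmxV //.
  by rewrite mul1mx !mulmxK // eX.
- by move=> _; rewrite !mulmxA mulVmx // mul1mx mulmxKV.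
- by move=> _; rewrite !mulmxA mulmxV // mul1mx mulmxK.
Qed.

Lemma sub1_lblock n (y : 'cV[F]_n) (Y : 'M_n) :
  block_mx (1%:M : 'M_1) 0 y Y - 1%:M = block_mx 0 0 y (Y - 1%:M).
Proof.
rewrite [X in _ - X]scalar_mx_block opp_block_mx add_block_mx.
by rewrite subrr !oppr0 !addr0.
Qed.

Lemma card_unipotents_diag n (c : 'M_1) (H : 'M_n) k : c != 0 ->
  #|[set Y in unipotents (block_mx c 0 0 H) k.+1
       | row_mx 1%:M 0 *m Y == row_mx 1%:M 0]| = #|unipotents H k|.
Proof.
move=> c0.
have E Y : block_mx (1%:M : 'M_1) 0 0 Y \in unipotents (block_mx c 0 0 H) k.+1
    = (Y \in unipotents H k).
  rewrite !inE unipotent_poly_lblock sub1_lblock rank_diag_block_mx mxrank0.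
  rewrite addnS add0n eqSS; congr (_ && _ && _).
  have := congr_diag_fixed theta H H (block_mx 1%:M 0 0 Y) c0.
  by rewrite row1_fixed !block_mxKdr block_mxKdl eqxx.
apply: (card_set_bij (f := drsubmx) (g := block_mx (1%:M : 'M_1) 0 0)) => Y.
- case/setIdP=> YU eY; rewrite -E.
  suff /eqP <- : Y == block_mx 1%:M 0 0 (drsubmx Y) by [].
  have := congr_diag_fixed theta H H Y c0; rewrite eY /=.
  by move: YU; rewrite !inE -!andbA => /andP[-> _] /esym/andP[].
- move=> YU; apply/setIdP; rewrite E; split=> //.
  by rewrite row1_fixed block_mxKdl block_mxKdr.
- case/setIdP=> YU eY.
  have := congr_diag_fixed theta H H Y c0; rewrite eY /=.
  by move: YU; rewrite !inE -!andbA => /andP[-> _] /esym/andP[/eqP <-].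
- by rewrite block_mxKdr.
Qed.

Lemma card_trace_fibre_mx (b : 'M_1) : b^! = b ->
  #|[set t : 'M_1 | t + t^! == b]| = q.
Proof.
move=> hb; have thb : theta (b 0 0) = b 0 0 by rewrite -[in RHS]hb !mxE.
rewrite -(card_trace_fibre q_gt1 cardF thetaE thb).
have E (t : F) : (t%:M + (t%:M : 'M_1)^! == b) = (t + theta t == b 0 0).
  rewrite hadj_scalar -raddfD /= {1}(mx11_scalar b).
  apply/eqP/eqP => [/matrixP/(_ 0 0)|->] //; by rewrite !mxE.
apply: (card_set_bij (f := fun t : 'M_1 => t 0 0) (g := scalar_mx)) => t.
- by rewrite !inE -E -mx11_scalar.
- by rewrite !inE E.
- by rewrite -mx11_scalar.
- by rewrite mxE eqxx.
Qed.

(** For an isometry [Y], the parameters (w, t) whose [hyperbolic_isometry] is an isometry with fixed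
    space of dimension [k]. *)
Definition fixing_pairs n (H Y : 'M[F]_n) (k : nat) :
    {set 'rV[F]_n * 'M[F]_1} :=
  [set p | (p.2 + p.2^! + p.1 *m H *m p.1^! == 0) &&
    (\rank (hyperbolic_isometry theta H Y p.1 p.2 - 1%:M)%R + k == n.+2)%N].

(** Sorts the isometries by the block [Y] induced on the quotient; by triangularity they are
    unipotent exactly when [Y] is. *)
Lemma card_unipotents_hyperbolic n (H : 'M_n) k : H^! = H ->
  #|[set Z in unipotents (hyperbolic_mx H) k
       | row_mx 1%:M 0 *m Z == row_mx 1%:M 0]| =
  (\sum_(Y in unipotent_isometries H) #|fixing_pairs H Y k|)%N.
Proof.
move=> hH.
have uniE Y w t : unipotent_poly (hyperbolic_isometry theta H Y w t) =
    unipotent_poly Y.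
  by rewrite unipotent_poly_lblock unipotent_poly_ublock.
have drE Y w t : drsubmx (drsubmx (hyperbolic_isometry theta H Y w t)) = Y.
  by rewrite !block_mxKdr.
have memE (Z : 'M_(1 + (1 + n))) :
    (Z \in [set Z in unipotents (hyperbolic_mx H) k
       | row_mx 1%:M 0 *m Z == row_mx 1%:M 0]) =
    [&& Z == hyperbolic_isometry theta H (drsubmx (drsubmx Z))
            (ursubmx (drsubmx Z)) (usubmx (dlsubmx Z)),
        drsubmx (drsubmx Z) \in unipotent_isometries H &
        (ursubmx (drsubmx Z), usubmx (dlsubmx Z))
          \in fixing_pairs H (drsubmx (drsubmx Z)) k].
  have /= E := congr_hyperbolic_fixed thetaK Z hH.
  apply/setIdP/and3P => [[]|[/eqP ZE]].
    rewrite !inE -andbA => /and3P[iZ uZ rZ] eZ.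
    move: E; rewrite iZ eZ /= => /esym/and3P[/eqP ZE -> ->] /=.
    split; [exact/eqP | | by rewrite -ZE].
    by rewrite -(uniE _ (ursubmx (drsubmx Z)) (usubmx (dlsubmx Z))) -ZE.
  rewrite !inE /= => /andP[iY uY] /andP[tE rZ].
  rewrite -ZE in rZ; have uZ : unipotent_poly Z by rewrite ZE uniE.
  by move: E; rewrite iY tE -ZE eqxx rZ uZ => /andP[-> ->].
rewrite -sum1_card (partition_big
   (fun Z : 'M_(1 + (1 + n)) => drsubmx (drsubmx Z))
   (mem (unipotent_isometries H))) /=; last first.
  by move=> Z; rewrite memE => /and3P[].
apply: eq_bigr => Y YU; rewrite sum1dep_card.
apply: (card_set_bij
   (f := fun Z => (ursubmx (drsubmx Z), usubmx (dlsubmx Z)))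
   (g := fun p => hyperbolic_isometry theta H Y p.1 p.2)) => [Z|[w t]|Z|[w t]].
- by rewrite [_ \in [set _ | _]]inE memE => /andP[/and3P[_ _ h] /eqP <-].
- rewrite [in X in _ -> X]inE memE drE eqxx andbT YU.
  by rewrite block_mxKdr block_mxKur block_mxKdl col_mxKu eqxx => ->.
- by rewrite inE memE => /andP[/and3P[/eqP ZE _ _] /eqP <-].
- by rewrite block_mxKdr block_mxKur block_mxKdl col_mxKu.
Qed.

End UnipotentCounting.

(** * The recursion in the dimension *)

Section UnipotentRecursion.

Variables (F : finFieldType) (q : nat) (theta : {rmorphism F -> F}).
Hypothesis q_gt1 : (1 < q)%N.
Hypothesis cardF : #|F| = (q ^ 2)%N.
Hypothesis thetaE : forall a : F, theta a = a ^+ q.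

Let thetaK := theta_involutive cardF thetaE.
Let trace_onto := theta_trace_onto q_gt1 cardF thetaE.

Local Notation "A ^!" := (hadj theta A) : ring_scope.
Local Notation congr := (congr_mx theta).
Local Notation unipotents := (unipotents theta).

(** Each [w] admits q values of [t]. Outside the row space of [Y - 1%:M] all of them give rank r +
    2; inside it one gives rank r and the others r + 1. *)
Lemma card_fixing_pairs n (H Y : 'M_n) k :
  hermitian_unit theta H -> congr Y H = H ->
  let r := \rank (Y - 1%:M) in
  #|fixing_pairs theta H Y k| =
    ((#|F| ^ n - #|F| ^ r) * (q * (r + k == n))
     + #|F| ^ r * (q.-1 * (r + k == n.+1) + (r + k == n.+2)))%N.
Proof.
move=> /andP[/eqP hH uH] YH r.
pose fib (w : 'rV_n) := [set t : 'M_1 | t + t^! == - (w *m H *m w^!)].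
have card_fib w : #|fib w| = q.
  apply: (card_trace_fibre_mx q_gt1 cardF thetaE).
  by rewrite hadjN !hadjM (hadjK thetaK) hH mulmxA.
pose fibk (w : 'rV_n) := [set t in fib w |
  (\rank (hyperbolic_isometry theta H Y w t - 1%:M)%R + k == n.+2)%N].
have -> : #|fixing_pairs theta H Y k| = (\sum_(w : 'rV_n) #|fibk w|)%N.
  rewrite -sum1_card (partition_big (fun p => p.1) predT) //=.
  apply: eq_bigr => w _; rewrite sum1dep_card.
  apply: (card_set_bij (f := fun p => p.2) (g := fun t => (w, t)))
    => [[w' t]|t|[w' t]|t] //=.
  - by rewrite !inE /= addr_eq0 => /andP[/andP[h1 h2] /eqP <-]; rewrite h1.
  - by rewrite !inE /= addr_eq0 => /andP[-> ->] /=.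
  - by rewrite inE /= => /andP[_ /eqP->].
have notin w : ~~ (w <= Y - 1%:M)%MS -> #|fibk w| = (q * (r + k == n))%N.
  move=> wY; have [rk|rk] := eqVneq (r + k)%N n.
    rewrite muln1 -(card_fib w); apply: eq_card => t; rewrite inE.
    by rewrite rank_hyperbolic_isometry_notin // !addSn rk eqxx andbT.
  rewrite muln0; apply: eq_card0 => t; rewrite inE.
  by rewrite rank_hyperbolic_isometry_notin // !addSn !eqSS (negbTE rk) andbF.
have isin w : (w <= Y - 1%:M)%MS ->
    #|fibk w| = (q.-1 * (r + k == n.+1) + (r + k == n.+2))%N.
  case/submxP=> z wE; pose t0 := z *m (Y - 1%:M) *m (H *m z^!).
  (* The exceptional value has the prescribed trace, so it is among the q admissible ones. *)
  have t0fib : t0 \in fib w.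
    rewrite inE wE /t0 -subr_eq0 opprK.
    (* This is Y H Y^! - H = 0 expanded in powers of Y - 1. *)
    have N : (Y - 1%:M) *m H + H *m (Y - 1%:M)^!
        + (Y - 1%:M) *m H *m (Y - 1%:M)^! = 0.
      rewrite mulmxBl mul1mx hadjB hadj1 !mulmxBr !mulmx1 mulmxBl.
      rewrite -/(congr Y H) YH.
      by rewrite -(opprB (H *m Y^!)) -opprD (addrC (_ - _)) subrr.
    have -> : z *m (Y - 1%:M) *m (H *m z^!) +
       (z *m (Y - 1%:M) *m (H *m z^!))^! +
       z *m (Y - 1%:M) *m H *m (z *m (Y - 1%:M))^! =
       z *m ((Y - 1%:M) *m H + H *m (Y - 1%:M)^!
             + (Y - 1%:M) *m H *m (Y - 1%:M)^!) *m z^!.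
      move: (Y - 1%:M) => M; rewrite !hadjM (hadjK thetaK) hH.
      by rewrite !mulmxDr !mulmxDl !mulmxA.
    by rewrite N mulmx0 mul0mx.
  have rankE t :
      \rank (hyperbolic_isometry theta H Y w t - 1%:M) = (r + (t != t0))%N.
    by rewrite wE rank_hyperbolic_isometry_in.
  rewrite (cardsD1 t0) inE t0fib rankE eqxx addn0.
  rewrite [(q.-1 * _ + _)%N]addnC; congr (_ + _)%N.
  have -> : q.-1 = #|fib w :\ t0|.
    by have := card_fib w; rewrite (cardsD1 t0) t0fib add1n => <-.
  have [rk|rk] := eqVneq (r + k)%N n.+1.
    rewrite muln1; apply: eq_card => t; rewrite !in_setD1.
    have [//|tt0] := eqVneq t t0.
    by rewrite inE rankE tt0 addn1 addSn rk eqxx andbT.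
  rewrite muln0; apply: eq_card0 => t; rewrite !in_setD1.
  have [//|tt0] := eqVneq t t0.
  by rewrite inE rankE tt0 addn1 addSn eqSS (negbTE rk) andbF.
rewrite (bigID (fun w : 'rV_n => (w <= Y - 1%:M)%MS)) /= addnC.
have card_in : #|[pred w : 'rV_n | (w <= Y - 1%:M)%MS]| = (#|F| ^ r)%N.
  by rewrite -card_rowspace cardsE.
congr (_ + _)%N.
  rewrite (eq_bigr _ notin) sum_nat_const; congr (_ * _)%N.
  have <- : #|{: 'rV[F]_n}| = (#|F| ^ n)%N by rewrite card_mx mul1n.
  rewrite -card_in -(cardC [pred w : 'rV_n | (w <= Y - 1%:M)%MS]).
  by rewrite addKn; apply: eq_card.
rewrite (eq_bigr _ isin) sum_nat_const -card_in; congr (_ * _)%N.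
Qed.

(** The indicator forces the rank to be n - j. For j > n both sides vanish, so the truncated
    subtraction is harmless. *)
Lemma sum_unipotent_rank n (H : 'M_n) (f : nat -> nat) j :
  (\sum_(Y in unipotent_isometries theta H)
     f (\rank (Y - 1%:M)%R) * (\rank (Y - 1%:M)%R + j == n))%N =
  (f (n - j) * #|unipotents H j|)%N.
Proof.
rewrite mulnC -sum_nat_const [in RHS](eq_bigl
  (fun Y => (Y \in unipotent_isometries theta H)
     && (\rank (Y - 1%:M)%R + j == n)%N)); last by move=> Y; rewrite inE.
rewrite big_mkcondr; apply: eq_bigr => Y _; case: eqP => [rj|_].
  by rewrite muln1 (canLR (addnK j) (esym rj)).
by rewrite muln0.
Qed.

Lemma sum_fixing_pairs n (H : 'M_n) k : hermitian_unit theta H ->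
  (\sum_(Y in unipotent_isometries theta H) #|fixing_pairs theta H Y k.+1|)%N =
  ((#|F| ^ n - #|F| ^ (n - k.+1)) * q * #|unipotents H k.+1|
   + #|F| ^ (n - k) * q.-1 * #|unipotents H k|
   + (if k is j.+1 then #|F| ^ (n - j) * #|unipotents H j| else 0))%N.
Proof.
move=> hH.
rewrite -(sum_unipotent_rank H (fun r => (#|F| ^ n - #|F| ^ r) * q)%N).
rewrite -(sum_unipotent_rank H (fun r => #|F| ^ r * q.-1)%N).
have -> : (if k is j.+1 then #|F| ^ (n - j) * #|unipotents H j| else 0)%N =
   (\sum_(Y in unipotent_isometries theta H)
     #|F| ^ (\rank (Y - 1%:M)%R) * (\rank (Y - 1%:M)%R + k == n.+1))%N.
  case: k => [|j]; last first.
    rewrite -(sum_unipotent_rank H (fun r => #|F| ^ r)%N).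
    by apply: eq_bigr => Y _; rewrite addnS eqSS.
  (* For [k] = 0 the indicator would require rank n + 1 of a matrix of size n. *)
  rewrite big1 // => Y _; rewrite addn0 ltn_eqF ?muln0 //.
  exact: leq_ltn_trans (rank_leq_row _) _.
rewrite -!big_split; apply: eq_bigr => Y; rewrite !inE => /andP[/eqP YH _].
rewrite card_fixing_pairs // !addnS !eqSS -!mulnA mulnDr /=.
by rewrite -!addnA.
Qed.

(** The pairs of an [X] and a nonzero vector that it fixes, counted in both orders. *)
Lemma unipotents_double_count n (H : 'M_n) k :
  (#|unipotents H k| * (#|F| ^ k).-1 =
  \sum_(v : 'rV_n | v != 0%R) #|[set X in unipotents H k | (v *m X == v)%R]|)%N.
Proof.
have E (v : 'rV_n) : #|[set X in unipotents H k | (v *m X == v)%R]| =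
   (\sum_(X in unipotents H k | (v *m X == v)%R) 1)%N.
  by rewrite sum1dep_card.
under [RHS]eq_bigr do rewrite E.
rewrite (exchange_big_dep (mem (unipotents H k))) /=; last first.
  by move=> v X _ /andP[].
rewrite -sum_nat_const; apply: eq_bigr => X XU; rewrite XU /=.
case/setIdP: XU => _ /eqP rX.
rewrite sum1dep_card -(_ : (n - \rank (X - 1%:M)%R)%N = k); last first.
  exact: canLR (addKn _) (esym rX).
rewrite -mxrank_ker -card_rowspace (cardsD1 0) inE sub0mx add1n /=.
apply: eq_card => v; rewrite !inE; congr (_ && _).
by rewrite (sameP sub_kermxP eqP) mulmxBr mulmx1 subr_eq0.
Qed.

Lemma unipotents_full n (H : 'M_n) : #|unipotents H n| = 1%N.
Proof.
rewrite -(cards1 (1%:M : 'M[F]_n)); apply: eq_card => X; rewrite !inE.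
rewrite (eqn_add2r n _ 0) mxrank_eq0 subr_eq0 andbC.
case: eqP => //= ->; rewrite congr_mx1 eqxx /unipotent_poly.
by rewrite /char_poly /char_poly_mx map_mx1 -raddfB /= det_scalar polyC1 eqxx.
Qed.

Lemma card_unipotents_anisotropic n (H : 'M_n.+1) (v : 'rV_n.+1) k (u : rat) :
  hermitian_unit theta H -> hnorm theta H v != 0 ->
  (forall H' : 'M_n, hermitian_unit theta H' -> #|unipotents H' k|%:R = u) ->
  #|[set X in unipotents H k.+1 | v *m X == v]|%:R = u.
Proof.
move=> hH hv IH; have vHv : v *m H *m v^! != 0.
  by apply: contraNneq hv => vHv; rewrite /hnorm vHv mxE.
have [P [H' [uP vP PH hH']]] := anisotropic_split thetaK (n := n) hH vHv.
by rewrite -vP card_unipotents_fibre // PH card_unipotents_diag // IH.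
Qed.

Lemma card_unipotents_isotropic n (H : 'M_n.+2) (v : 'rV_n.+2) k
    (u : nat -> rat) :
  hermitian_unit theta H -> v != 0 -> hnorm theta H v = 0 ->
  (forall (H' : 'M_n) j, hermitian_unit theta H' ->
     #|unipotents H' j|%:R = u j) ->
  #|[set X in unipotents H k.+1 | v *m X == v]|%:R =
    (q%:R ^+ (2 * n) - q%:R ^+ (2 * (n - k.+1))) * q%:R * u k.+1
    + q%:R ^+ (2 * (n - k)) * (q%:R - 1) * u k
    + (if k is j.+1 then q%:R ^+ (2 * (n - j)) * u j else 0).
Proof.
move=> hH v0 hv IH; have vHv : v *m H *m v^! = 0 by rewrite hnorm_mx hv raddf0.
have [P [H' [uP vP PH hH']]] :=
  isotropic_split thetaK trace_onto (n := n) hH v0 vHv.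
rewrite -vP card_unipotents_fibre // PH.
rewrite (card_unipotents_hyperbolic cardF thetaE); last first.
  by case/andP: hH' => /eqP.
rewrite sum_fixing_pairs // cardF !natrD !natrM natrB; last first.
  by rewrite leq_exp2l ?leq_subr // -(exp1n 2) ltn_exp2r.
rewrite !natrX -!exprM -subn1 natrB ?(ltnW q_gt1) // !IH //.
by case: k => [//|j]; rewrite natrM !natrX -exprM IH.
Qed.

(** [u1] and [u0] stand for the counts known by induction. The factor of [u1 k] is the number of
    anisotropic vectors; the next one omits the zero vector from the isotropic ones. *)
Lemma unipotents_rec n (H : 'M_n.+2) k (u1 u0 : nat -> rat) :
  hermitian_unit theta H ->
  (forall (H' : 'M_n.+1) j, hermitian_unit theta H' ->
     #|unipotents H' j|%:R = u1 j) ->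
  (forall (H' : 'M_n) j, hermitian_unit theta H' ->
     #|unipotents H' j|%:R = u0 j) ->
  #|unipotents H k.+1|%:R * (q%:R ^+ (2 * k.+1) - 1) =
    (q%:R ^+ (2 * n.+2) - (nvec theta H 0)%:R) * u1 k
    + ((nvec theta H 0)%:R - 1)
      * ((q%:R ^+ (2 * n) - q%:R ^+ (2 * (n - k.+1))) * q%:R * u0 k.+1
         + q%:R ^+ (2 * (n - k)) * (q%:R - 1) * u0 k
         + (if k is j.+1 then q%:R ^+ (2 * (n - j)) * u0 j else 0)).
Proof.
move=> hH IH1 IH0.
have F1 : (0 < #|F|)%N by rewrite cardF expn_gt0 ltnW.
have := congr1 (fun x => x%:R : rat) (unipotents_double_count H k.+1).
rewrite natrM -subn1 natrB ?expn_gt0 ?F1 // natrX {1}cardF natrX -exprM => ->.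
rewrite natr_sum (bigID (fun v => hnorm theta H v == 0)) /= addrC.
congr (_ + _).
  rewrite (eq_bigr (fun=> u1 k)) => [|v /andP[_ hv]]; last first.
    by apply: card_unipotents_anisotropic => // H' hH'; exact: IH1.
  rewrite sumr_const -[u1 k *+ _]mulr_natl; congr (_ * _).
  have := cardC [pred v : 'rV_n.+2 | hnorm theta H v == 0].
  rewrite card_mx mul1n cardF => /(congr1 (fun x => x%:R : rat)).
  rewrite natrD !natrX -exprM => <-.
  rewrite /nvec cardsE addrAC subrr add0r; congr _%:R; apply: eq_card => v.
  rewrite !inE unfold_in; case: (v =P 0) => [->|//].
  by rewrite /hnorm !mul0mx mxE eqxx.
set T := (X in _ = _ * X).
rewrite (eq_bigr (fun=> T)) => [|v /andP[v0 /eqP hv]]; last first.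
  exact: card_unipotents_isotropic.
rewrite sumr_const -[T *+ _]mulr_natl; congr (_ * _).
rewrite /nvec (cardsD1 0) inE /hnorm !mul0mx mxE eqxx natrD addrC addKr.
by congr _%:R; apply: eq_card => v; rewrite !inE.
Qed.

End UnipotentRecursion.

(** * The closed formula *)

Section Formula.

Variable q : nat.
Hypothesis q_gt1 : (1 < q)%N.

Local Notation Q := (- q%:R : rat).
Local Notation order := (unitary_order q).

Definition unipotent_formula (n k : nat) : rat :=
  (order n / order k) *
  ((\prod_(k <= i < n) (1 - 1 / Q ^+ i)) /
   (q%:R ^+ (n - k) * \prod_(1 <= i < (n - k).+1) (1 - 1 / Q ^+ i))).

(** For k > n the truncated [n - k] would leave a nonzero value in the formula. *)
Definition unipotent_number (n k : nat) : rat :=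
  if (k <= n)%N then unipotent_formula n k else 0.

(* The ratios between neighbouring values of [unipotent_number] have
   denominator [beta n], which vanishes only for n = 0 and n = 1. *)
Let beta (n : nat) : rat := (Q ^+ n - 1) * (Q ^+ n + q%:R) / q%:R.

Let qR_gt1 : 1 < q%:R :> rat.
Proof. by rewrite ltr1n. Qed.

Let qR_neq0 : q%:R != 0 :> rat.
Proof. by rewrite pnatr_eq0 -lt0n ltnW. Qed.

Let Q_neq0 : Q != 0.
Proof. by rewrite oppr_eq0. Qed.

Lemma norm_expQ n : `|Q ^+ n| = q%:R ^+ n.
Proof. by rewrite normrX normrN normr_nat. Qed.

Lemma expQ_neq1 n : (0 < n)%N -> Q ^+ n != 1.
Proof.
move=> n0; apply/negP => /eqP/(congr1 (fun x => `|x|)).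
by rewrite norm_expQ normr1 => /eqP; rewrite gt_eqF // exprn_egt1 -?lt0n.
Qed.

(** In absolute value q^n > q; for n = 1 the sum is 0. *)
Lemma expQ_neqNq n : (1 < n)%N -> Q ^+ n + q%:R != 0.
Proof.
move=> n1; rewrite addr_eq0; apply/negP => /eqP/(congr1 (fun x => `|x|)).
rewrite norm_expQ normrN normr_nat => /eqP; rewrite gt_eqF //.
by rewrite -{1}[q%:R]expr1 ltr_eXn2l.
Qed.

Lemma beta_neq0 n : (1 < n)%N -> beta n != 0.
Proof.
move=> n1; rewrite !mulf_neq0 ?invr_neq0 ?expQ_neqNq // subr_eq0 expQ_neq1 //.
exact: ltnW.
Qed.

Lemma unitary_orderS n :
  order n.+1 = order n * (q%:R ^+ n * (q%:R ^+ n.+1 - (-1) ^+ n.+1)).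
Proof. by rewrite /unitary_order big_ord_recr. Qed.

(** Absorbs the sign into powers of -q, the base used in the closed formula. *)
Lemma expq_sign n : q%:R ^+ n * (q%:R ^+ n.+1 - (-1) ^+ n.+1) =
  (Q ^+ n.+1 - 1) * Q ^+ n.+1 / q%:R.
Proof.
rewrite (exprNn q%:R) (exprS q%:R); have : ((-1) ^+ n.+1) ^+ 2 = 1 :> rat.
  by rewrite -exprM mulnC exprM sqrrN !expr1n.
move: (q%:R ^+ n) ((-1) ^+ n.+1) => x s ss.
by apply: (mulIf qR_neq0); rewrite divfK //; ring: ss.
Qed.

Lemma unitary_order_neq0 n : order n != 0.
Proof.
elim: n => [|n IHn]; first by rewrite /unitary_order big_ord0 oner_neq0.
rewrite unitary_orderS expq_sign !mulf_neq0 ?invr_neq0 ?expf_neq0 //.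
by rewrite subr_eq0 expQ_neq1.
Qed.

Lemma prod_factor_neq0 n : \prod_(1 <= i < n.+1) (1 - 1 / Q ^+ i) != 0.
Proof.
rewrite prodf_seq_neq0; apply/allP => i; rewrite mem_index_iota => /andP[i0 _].
rewrite /= div1r subr_eq0 eq_sym invr_eq1; exact: expQ_neq1.
Qed.

Lemma unipotent_number_diag n : unipotent_number n n = 1.
Proof.
rewrite /unipotent_number leqnn /unipotent_formula subnn !big_geq // expr0.
by rewrite mulfV ?unitary_order_neq0 // !mul1r divr1.
Qed.

Lemma unipotent_number0 n : unipotent_number n.+1 0 = 0.
Proof.
rewrite /unipotent_number leq0n /unipotent_formula big_ltn // expr0 divr1 subrr.
by rewrite !mul0r mulr0.
Qed.

Lemma unipotent_number_gt n k : (n < k)%N -> unipotent_number n k = 0.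
Proof. by move=> ltnk; rewrite /unipotent_number leqNgt ltnk. Qed.

Let alpha (n : nat) : rat := q%:R ^+ n * (q%:R ^+ n.+1 - (-1) ^+ n.+1).

Lemma alpha_neq0 n : alpha n != 0.
Proof.
rewrite /alpha expq_sign !mulf_neq0 ?invr_neq0 ?expf_neq0 //.
by rewrite subr_eq0 expQ_neq1.
Qed.

Lemma betaE n : beta n.+1 = alpha n * (1 - 1 / Q ^+ n).
Proof.
rewrite /alpha expq_sign /beta exprS; have := expf_neq0 n Q_neq0.
by move: (Q ^+ n) => x x0; field; rewrite x0 qR_neq0.
Qed.

(** The difference n - k is unchanged, so only the orders and the two ends of the numerator product
    differ. *)
Lemma unipotent_number_SS n k :
  unipotent_number n.+1 k * beta n.+2 = unipotent_number n.+2 k.+1 * beta k.+1.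
Proof.
rewrite /unipotent_number ltnS; case: leqP => [lekn|_]; last by rewrite !mul0r.
rewrite /unipotent_formula subSS [order n.+2]unitary_orderS (unitary_orderS k).
rewrite !betaE.
rewrite -/(alpha n.+1) -/(alpha k).
have AB : \prod_(k <= i < n.+1) (1 - 1 / Q ^+ i) * (1 - 1 / Q ^+ n.+1) =
    (1 - 1 / Q ^+ k) * \prod_(k.+1 <= i < n.+2) (1 - 1 / Q ^+ i).
  by rewrite -big_nat_recr //= -big_ltn // ltnS (leq_trans lekn).
have := alpha_neq0 k; have := unitary_order_neq0 k.
have := prod_factor_neq0 (n.+1 - k); have := expf_neq0 (n.+1 - k) qR_neq0.
move: AB (order n.+1) (alpha n.+1) (order k) (alpha k).
move: (\prod_(k <= i < n.+1) _) (\prod_(k.+1 <= i < n.+2) _)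
  (\prod_(1 <= i < _) _).
move: (1 - 1 / Q ^+ n.+1) (1 - 1 / Q ^+ k) (q%:R ^+ (n.+1 - k)).
move=> a b d A B D AB u al uk alk d0 D0 uk0 alk0.
transitivity (u / uk * al / (d * D) * (A * a)).
  by field; rewrite d0 D0 uk0.
by rewrite AB; field; rewrite d0 D0 uk0 alk0.
Qed.

(** Raising n alone adds one factor to the order, to each product and to the power of q. *)
Lemma unipotent_number_S n k :
  unipotent_number n.+1 k * beta n.+2 =
  unipotent_number n.+2 k * (q%:R * (1 - Q ^+ k / Q ^+ n.+2)).
Proof.
rewrite /unipotent_number; case: leqP => lekn; last first.
  rewrite mul0r; case: leqP => lekn2; last by rewrite mul0r.
  (* The left side is 0 by convention, and the last factor on the right vanishes. *)
  have -> : k = n.+2 by lia.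
  by rewrite mulfV ?expf_neq0 // subrr !mulr0.
rewrite (leq_trans lekn) // /unipotent_formula [order n.+2]unitary_orderS betaE.
rewrite -/(alpha n.+1) [in RHS]subSn // [in RHS]big_nat_recr //=.
rewrite [\prod_(1 <= i < (n.+1 - k).+2) _]big_nat_recr //=.
rewrite (exprS q%:R (n.+1 - k)).
have -> : Q ^+ k / Q ^+ n.+2 = 1 / Q ^+ (n.+1 - k).+1.
  have -> : Q ^+ n.+2 = Q ^+ k * Q ^+ (n.+1 - k).+1.
    by rewrite -exprD -subSn ?subnKC // (leq_trans lekn).
  by field; rewrite !expf_neq0.
have : 1 - 1 / Q ^+ (n.+1 - k).+1 != 0.
  by rewrite div1r subr_eq0 eq_sym invr_eq1 expQ_neq1.
have := unitary_order_neq0 k; have := prod_factor_neq0 (n.+1 - k).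
have := expf_neq0 (n.+1 - k) qR_neq0.
move: (\prod_(k <= i < n.+1) _) (\prod_(1 <= i < _) _) (q%:R ^+ (n.+1 - k)).
move: (1 - 1 / Q ^+ n.+1) (1 - 1 / Q ^+ _.+1) (order n.+1) (alpha n.+1)
  (order k).
by move=> a b u al uk A D d d0 D0 uk0 b0; field; rewrite d0 D0 uk0 b0 qR_neq0.
Qed.

(** The two ratio lemmas express every value through [G], leaving an identity of rational functions
    in q, (-q)^k and (-q)^(n+1). Starting in dimension 3 keeps the denominator [beta n.+2]
    nonzero. *)
Lemma unipotent_number_rec n k (z : rat) :
  z * q%:R = q%:R ^+ (2 * n.+3) + (- q%:R) ^+ n.+3 * (q%:R - 1) ->
  unipotent_number n.+3 k.+1 * (q%:R ^+ (2 * k.+1) - 1) =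
    (q%:R ^+ (2 * n.+3) - z) * unipotent_number n.+2 k
    + (z - 1)
      * ((q%:R ^+ (2 * n.+1) - q%:R ^+ (2 * (n.+1 - k.+1))) * q%:R
           * unipotent_number n.+1 k.+1
         + q%:R ^+ (2 * (n.+1 - k)) * (q%:R - 1) * unipotent_number n.+1 k
         + (if k is j.+1
            then q%:R ^+ (2 * (n.+1 - j)) * unipotent_number n.+1 j else 0)).
Proof.
move=> zE; set G := unipotent_number n.+3 k.+1.
have q2E m : q%:R ^+ (2 * m) = (Q ^+ m) ^+ 2 :> rat.
  by rewrite -[RHS]exprM [in RHS]mulnC [RHS]exprM sqrrN -exprM.
(* Trades the truncated exponent for a quotient: wherever truncation occurs, the value multiplied by
   it is 0. *)
have shift j : q%:R ^+ (2 * (n.+1 - j)) * unipotent_number n.+1 j =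
    (Q ^+ n.+1 / Q ^+ j) ^+ 2 * unipotent_number n.+1 j.
  have [lejn|ltnj] := leqP j n.+1; last first.
    by rewrite unipotent_number_gt // !mulr0.
  by rewrite q2E expfB_cond // (negbTE Q_neq0).
have b3 := beta_neq0 (n := n.+3) isT; have b2 := beta_neq0 (n := n.+2) isT.
have E1 : unipotent_number n.+2 k = G * beta k.+1 / beta n.+3.
  by rewrite -unipotent_number_SS mulfK.
have E2 : unipotent_number n.+1 k.+1 =
    G * (q%:R * (1 - Q ^+ k.+1 / Q ^+ n.+3)) / beta n.+3
    * (q%:R * (1 - Q ^+ k.+1 / Q ^+ n.+2)) / beta n.+2.
  by rewrite -unipotent_number_S mulfK // -unipotent_number_S mulfK.
have E3 : unipotent_number n.+1 k = G * beta k.+1 / beta n.+3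
    * (q%:R * (1 - Q ^+ k / Q ^+ n.+2)) / beta n.+2.
  by rewrite -E1 -unipotent_number_S mulfK.
(* For k = 0 the factor [beta 0] = 0 reproduces the default value, so one expression covers both
   cases. *)
have E4 : (if k is j.+1
      then q%:R ^+ (2 * (n.+1 - j)) * unipotent_number n.+1 j else 0) =
    (Q ^+ n.+1 / (Q ^+ k / Q)) ^+ 2
      * (G * beta k.+1 / beta n.+3 * beta k / beta n.+2).
  case: (k) E1 => [_|j E1].
    by rewrite /beta expr0 subrr !mul0r !mulr0 mul0r mulr0.
  rewrite shift -E1 -unipotent_number_SS mulfK //; congr (_ ^+ 2 * _).
  by rewrite (exprSr Q j) mulfK.
have x0 := expf_neq0 k Q_neq0; have y0 := expf_neq0 n.+1 Q_neq0.
have T1 : (q%:R ^+ (2 * n.+1) - q%:R ^+ (2 * (n.+1 - k.+1))) * q%:R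
      * unipotent_number n.+1 k.+1 =
    ((Q ^+ n.+1) ^+ 2 - (Q ^+ n.+1 / Q ^+ k.+1) ^+ 2) * q%:R
      * unipotent_number n.+1 k.+1.
  by rewrite mulrAC mulrBl shift q2E -mulrBl mulrAC.
have T2 : q%:R ^+ (2 * (n.+1 - k)) * (q%:R - 1) * unipotent_number n.+1 k =
    (Q ^+ n.+1 / Q ^+ k) ^+ 2 * (q%:R - 1) * unipotent_number n.+1 k.
  by rewrite mulrAC shift mulrAC.
rewrite T1 T2 E1 E2 E3 E4 !q2E {T1 T2 E1 E2 E3 E4 shift}.
have {zE}-> : z = ((Q ^+ n.+3) ^+ 2 + Q ^+ n.+3 * (q%:R - 1)) / q%:R.
  by rewrite -q2E -zE mulfK.
have : Q ^+ n.+3 - 1 != 0 by rewrite subr_eq0 expQ_neq1.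
have : Q ^+ n.+2 - 1 != 0 by rewrite subr_eq0 expQ_neq1.
have : Q ^+ n.+3 + q%:R != 0 by rewrite expQ_neqNq.
have : Q ^+ n.+2 + q%:R != 0 by rewrite expQ_neqNq.
rewrite /beta !(exprS Q n.+2) !(exprS Q n.+1) !(exprS Q k).
move: (q%:R : rat) qR_neq0 x0 y0 => r r0 x0 y0 d1 d2 d3 d4.
by field; rewrite r0 d1 d3 d2 d4 x0 y0.
Qed.

Lemma expq_double_sub1_neq0 k : q%:R ^+ (2 * k.+1) - 1 != 0 :> rat.
Proof. by rewrite subr_eq0 gt_eqF // exprn_egt1. Qed.

End Formula.

(** * Agreement of the count with the closed formula *)

Section Main.

Variables (F : finFieldType) (q : nat) (theta : {rmorphism F -> F}).
Hypothesis q_gt1 : (1 < q)%N.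
Hypothesis cardF : #|F| = (q ^ 2)%N.
Hypothesis thetaE : forall a : F, theta a = a ^+ q.

(** Strong induction: the cases k > n, k = n and k = 0 are direct, and otherwise both sides satisfy
    the same recursion. *)
Lemma card_unipotents n (H : 'M_n) k : hermitian_unit theta H ->
  #|unipotents theta H k|%:R = unipotent_number q n k.
Proof.
elim/ltn_ind: n H k => n IHn H k hH.
have [ltnk|] := ltnP n k.
  by rewrite unipotents_gt // unipotent_number_gt.
rewrite leq_eqVlt => /predU1P[->|ltkn].
  by rewrite unipotents_full unipotent_number_diag.
case: n => [//|n] in H hH IHn ltkn *; case: k => [|k] in ltkn *.
  by rewrite unipotents_0 unipotent_number0.
case: n => [//|n] in H hH IHn ltkn *.
have rec := unipotents_rec q_gt1 cardF thetaE k hH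
  (fun H' j => IHn n.+1 (ltnSn _) H' j) (fun H' j => IHn n (leqnSn _) H' j).
have [zE _] := nvecE q_gt1 cardF thetaE hH.
apply: (mulIf (expq_double_sub1_neq0 q_gt1 k)); rewrite {}rec.
(* Dimension 2 is computed by hand, since the general argument would divide by [beta 1] = 0. *)
case: n => [|n] in H hH IHn ltkn zE *; last first.
  by rewrite -unipotent_number_rec.
case: k ltkn => [_|//].
rewrite unipotent_number0 mulr0 add0r !(unipotent_number_diag q_gt1).
rewrite [unipotent_number q 0 1]unipotent_number_gt // !mulr0 add0r addr0.
rewrite mul1r mulr1.
have -> : unipotent_number q 2 1 = q%:R ^+ 2 - 1.
  rewrite /unipotent_number /= /unipotent_formula /unitary_order.
  rewrite !big_ord_recr !big_ord0 !big_nat1 /=.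
  have q0 : q%:R != 0 :> rat by rewrite pnatr_eq0 -lt0n ltnW.
  have q1 : q%:R + 1 != 0 :> rat by rewrite natr1 pnatr_eq0.
  by field; rewrite q0 q1 -opprD oppr_eq0 q1.
have q0 : q%:R != 0 :> rat by rewrite pnatr_eq0 -lt0n ltnW.
apply: (mulIf q0); rewrite mulrAC mulrBl zE; ring.
Qed.

End Main.

(** * Unipotency and fixed spaces in matrix terms *)

Lemma unipotentP (F : finFieldType) n (g : 'M[F]_n) :
  unipotent g <-> unipotent_poly g.
Proof.
split=> [ug|/eqP gE L iota a]; last first.
  rewrite eigenvalue_root_char -map_char_poly gE rmorphXn rmorphB /= map_polyX.
  rewrite map_polyC /= rmorph1 rootE !hornerE.
  by rewrite expf_eq0 subr_eq0 => /andP[_ /eqP].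
have p0 : char_poly g != 0 by rewrite monic_neq0 // char_poly_monic.
(* Over a splitting field all roots are eigenvalues, hence equal to 1; here the extension fields in
   [unipotent] come in. *)
have [L [rs prs _]] := FinSplittingFieldFor p0.
have mon : map_poly (GRing.in_alg L) (char_poly g) \is monic.
  by rewrite map_monic char_poly_monic.
have {}prs : map_poly (GRing.in_alg L) (char_poly g) =
    \prod_(z <- rs) ('X - z%:P).
  by apply/eqP; rewrite -eqp_monic // monic_prod_XsubC.
have rs1 : all (pred1 1) rs.
  apply/allP => z zrs; apply/eqP; apply: (ug L (GRing.in_alg L)).
  by rewrite eigenvalue_root_char -map_char_poly /= prs root_prod_XsubC.
have E : map_poly (GRing.in_alg L) (char_poly g) = ('X - 1%:P) ^+ size rs.
  rewrite prs (eq_big_seq (fun=> 'X - 1%:P)) => [|z /(allP rs1)/eqP-> //].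
  by rewrite big_const_seq count_predT -Monoid.iteropE.
have sz : size rs = n.
  have := congr1 (fun p : {poly L} => size p) E.
  by rewrite size_map_poly size_char_poly size_exp_XsubC => -[].
apply/eqP; apply: (map_poly_inj (GRing.in_alg L)); rewrite [LHS]E sz.
by rewrite rmorphXn rmorphB /= map_polyX map_polyC /= scale1r.
Qed.

(** Transposition maps the fixed columns onto a row kernel; equal cardinals, as powers of |F| > 1,
    give equal dimensions. *)
Lemma dim_fixed_space (F : finFieldType) n (g : 'M[F]_n) :
  \dim (fixed_space g) = (n - \rank (g^T - 1%:M)%R)%N.
Proof.
have F1 : (1 < #|F|)%N by exact: card_finRing_gt1.
apply/eqP; rewrite -(eqn_exp2l _ _ F1) -mxrank_ker -card_rowspace.
rewrite -card_vspace -(card_imset _ (can_inj (@trmxK F n 1))).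
apply/eqP; apply: eq_card => w; rewrite inE (sameP sub_kermxP eqP).
rewrite mulmxBr mulmx1 subr_eq0; apply/imsetP/eqP => [[v /fixedSpaceP]|wg].
  by rewrite lfunE /= => gv ->; rewrite -trmx_mul gv.
exists w^T; last by rewrite trmxK.
by apply/fixedSpaceP; rewrite lfunE /= -[g]trmxK -trmx_mul wg.
Qed.

(** * Matrices of Hermitian forms *)

Section Forms.

Variables (F : finFieldType) (theta : {rmorphism F -> F}).
Variables (n : nat) (form : {hermitian 'cV[F]_n for false & theta}).

Local Notation "A ^!" := (hadj theta A) : ring_scope.

Definition form_mx : 'M[F]_n :=
  \matrix_(i, j) form (delta_mx i 0) (delta_mx j 0).

Lemma form_mxE (u v : 'cV_n) : form u v = (u^T *m form_mx *m (v^T)^!) 0 0.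
Proof.
have colE (w : 'cV[F]_n) : w = \sum_i w i 0 *: delta_mx i 0.
  by rewrite {1}(matrix_sum_delta w); apply: eq_bigr => i _; rewrite big_ord1.
rewrite {1}(colE u) {1}(colE v) linear_sumlz mxE /=.
under [RHS]eq_bigr do rewrite mxE big_distrl.
rewrite [RHS]exchange_big /=; apply: eq_bigr => i _.
rewrite linear_sumr; apply: eq_bigr => j _.
rewrite linearZl_LR linearZr_LR /= !mxE.
by rewrite mulrA mulrAC.
Qed.

Hypothesis form_nondeg : nondegenerate form.

(** A row vector killed by the Gram matrix is, once transposed, orthogonal to the whole space. *)
Lemma form_mx_hermitian_unit : hermitian_unit theta form_mx.
Proof.
apply/andP; split.
  by apply/eqP/matrixP => i j; rewrite !mxE [RHS]hermC expr0 mul1r.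
rewrite -row_free_unit; apply: inj_row_free => w wH.
suff : w^T \in orthov form fullv.
  move: form_nondeg; rewrite /nondegenerate => /eqP ->.
  by rewrite memv0 => /eqP/(congr1 trmx); rewrite trmxK trmx0.
apply/mem_orthovP => v _.
by rewrite form_mxE trmxK wH mul0mx mxE.
Qed.

Lemma mul_delta_hadj (D : 'M[F]_n) i j :
  ((delta_mx i 0 : 'cV_n)^T *m D *m ((delta_mx j 0 : 'cV_n)^T)^!) 0 0 = D i j.
Proof.
by rewrite /hadj !trmx_delta map_delta_mx trmx_delta -rowE -colE !mxE.
Qed.

(** The transpose passes from the action on columns to that on rows; evaluating the form on basis
    vectors recovers the matrix entries. *)
Lemma unitary_groupE (g : 'M_n) :
  (g \in unitary_group form) = (g^T \in isometries theta form_mx form_mx).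
Proof.
have /andP[_ uH] := form_mx_hermitian_unit.
have formE (u v : 'cV_n) : form (g *m u) (g *m v) =
    (u^T *m congr_mx theta g^T form_mx *m (v^T)^!) 0 0.
  by rewrite form_mxE !trmx_mul hadjM /congr_mx !mulmxA.
rewrite !inE; apply/andP/eqP => [[ug /forallP h]|gE].
  apply/matrixP => i j.
  have /forallP/(_ (delta_mx j 0))/eqP := h (delta_mx i 0).
  by rewrite formE form_mxE !mul_delta_hadj.
split.
  (* Invertibility of [g] comes from that of the Gram matrix, of which [g^T] is a factor. *)
  move: uH; rewrite -{1}gE /congr_mx !unitmx_mul unitmx_tr.
  by case/andP=> /andP[].
by apply/forallP => u; apply/forallP => v; rewrite formE gE form_mxE.
Qed.

Lemma card_unitary_group :
  #|unitary_group form| = #|isometries theta form_mx form_mx|.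
Proof.
apply: (card_set_bij (f := trmx) (g := trmx)) => g; rewrite ?trmxK //.
  by rewrite unitary_groupE.
by rewrite unitary_groupE trmxK.
Qed.

Lemma card_unitary_unipotents k : (k <= n)%N ->
  #|unitary_unipotents form k| = #|unipotents theta form_mx k|.
Proof.
move=> lekn.
have E (g : 'M_n) :
    (g \in unitary_unipotents form k) = (g^T \in unipotents theta form_mx k).
  rewrite inE unitary_groupE dim_fixed_space [RHS]inE.
  rewrite [g^T \in unipotent_isometries _ _]inE -[RHS]andbA.
  congr (_ && (_ && _)).
    by rewrite /unipotent_poly char_poly_tr; apply/asboolP/idP => /unipotentP.
  have := rank_leq_row (g^T - 1%:M); move: (\rank _) => r lern.
  by apply/eqP/eqP; lia.
apply: (card_set_bij (f := trmx) (g := trmx)) => g; rewrite ?trmxK //.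
  by rewrite E.
by rewrite E trmxK.
Qed.

End Forms.

Theorem theorem7 (p e q : nat) (hp : prime p) (he : (0 < e)%N)
    (hq : q = (p ^ e)%N)
    (F : finFieldType) (hF : #|F| = (q ^ 2)%N)
    (theta : {rmorphism F -> F}) (htheta : forall a : F, theta a = a ^+ q)
    (n k : nat) (hn : (0 < n)%N) (hkn : (k <= n)%N)
    (form_n : {hermitian 'cV[F]_n for false & theta})
    (hform_n : nondegenerate form_n)
    (form_k : {hermitian 'cV[F]_k for false & theta})
    (hform_k : nondegenerate form_k) :
  #|unitary_unipotents form_n k|%:R =
    (#|unitary_group form_n|%:R / #|unitary_group form_k|%:R) *
    ((\prod_(k <= i < n) (1 - 1 / (- q%:R) ^+ i)) /
     (q%:R ^+ (n - k) *
      \prod_(1 <= i < (n - k).+1) (1 - 1 / (- q%:R) ^+ i))) :> rat.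
Proof.
have q_gt1 : (1 < q)%N by rewrite hq -(exp1n e) ltn_exp2r // prime_gt1.
have hn' := form_mx_hermitian_unit hform_n.
have hk' := form_mx_hermitian_unit hform_k.
rewrite (card_unitary_unipotents hform_n hkn) !card_unitary_group //.
rewrite (card_unipotents q_gt1 hF htheta _ hn') /unipotent_number hkn.
by rewrite !(card_isometries q_gt1 hF htheta).
Qed.
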